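(* Consider the two-dimensional risk model with constant interest rate described in the context (with $c_1/\delta_1>c_2/\delta_2$). For $T>0$ and $x_1,x_2$, let $$\Psi_{\min}(x_1,x_2,T)=P\{T_{\min}(\delta_1x_1,\delta_2x_2)\le T\}=P\{\exists\,t\le T:\ X_1(t)<0\text{ or }X_2(t)<0\},$$ where $X_i(t)=x_i+p_i(1-e^{-rt})-\sum_{k=1}^{N(t)}e^{-r\theta_k}\sigma_k$ and $p_i=\frac{c_i}{r\delta_i}$. Let $V$ be uniformly distributed on $(0,T]$, independent of $\sigma_1$, and $F_T(x)=P\{e^{-rV}\sigma_1\le x\}$, $\overline{F_T}=1-F_T$. Suppose $P\{\sigma_k>x\}=L(x)/x^{\alpha}$, where $\alpha>0$ and $L$ is continuous, slowly varying, with $\lim_{x\to\infty}L(x)=\infty$. Then for any $T>0$, $$\lim_{x_2\ge x_1\to\infty}\frac{\Psi_{\min}(x_1,x_2,T)}{\lambda T\,\overline{F_T}(x_1)}=1,$$ the limit being taken as $x_1\to\infty$ over pairs with $x_2\ge x_1$.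
   Context: Model: $U_i(t)=e^{rt}u_i+\frac{c_i}{r}(e^{rt}-1)-\delta_i\sum_{k=1}^{N(t)}e^{r(t-\theta_k)}\sigma_k$, $i=1,2$, where $r>0$ is the interest rate, $u_i$ initial reserves, $c_i>0$ premium rates, $0<\delta_1,\delta_2<1$ with $\delta_1+\delta_2=1$, $N(t)$ a Poisson process with intensity $\lambda>0$, $\{\sigma_k\}$ i.i.d. nonnegative claim sizes independent of $N$, and $\theta_k$ the $k$-th arrival time of $N$. $T_{\min}(u_1,u_2)=\inf\{t\ge0:\min\{U_1(t),U_2(t)\}<0\}$. Standing assumption $c_1/\delta_1>c_2/\delta_2$, i.e. $p_1>p_2$. Note $X_i(t)=e^{-rt}U_i(t)/\delta_i$ with $x_i=u_i/\delta_i$. *)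

(* Defs.v *)
From HB Require Import structures.
From mathcomp Require Import all_boot all_order all_algebra.
From mathcomp Require Import all_classical all_reals all_analysis.
Set Implicit Arguments. Unset Strict Implicit. Unset Printing Implicit Defensive.
Import Order.TTheory GRing.Theory Num.Theory.
Import numFieldNormedType.Exports.
Local Open Scope classical_set_scope.
Local Open Scope ring_scope.

Section Defs.
Context {R : realType} {d : measure_display} {Omega : measurableType d}.

Definition mutually_independent (I : eqType) (P : probability Omega R)
    (Z : I -> Omega -> R) : Prop :=
  (forall i, measurable_fun setT (Z i)) /\
  forall (J : seq I) (B : I -> set R), uniq J -> (forall i, measurable (B i)) ->
    P (\bigcap_(i in [set i | i \in J]) (Z i @^-1` B i)) =
    (\prod_(i <- J) P (Z i @^-1` B i))%E.

Definition claim_family (E sigma : nat -> Omega -> R) (i : nat + nat) : Omega -> R :=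
  match i with inl k => E k | inr k => sigma k end.

(* Arrival times: theta k = E 0 + ... + E k  (the (k+1)-th arrival time). *)
Definition arrival (E : nat -> Omega -> R) (k : nat) (w : Omega) : R :=
  \sum_(i < k.+1) E i w.

(* N(t)(w) = n : exactly the first n arrivals have occurred by time t. *)
Definition counts (theta : nat -> Omega -> R) (t : R) (w : Omega) (n : nat) : Prop :=
  (forall k, (k < n)%N -> theta k w <= t) /\ t < theta n w.

Definition disc_surplus (r x p : R) (theta sigma : nat -> Omega -> R)
    (n : nat) (t : R) (w : Omega) : R :=
  x + p * (1 - expR (- (r * t))) - \sum_(k < n) expR (- (r * theta k w)) * sigma k w.

Definition Psi_min (P : probability Omega R) (r p1 p2 : R)
    (E sigma : nat -> Omega -> R) (x1 x2 T : R) : R :=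
  fine (P [set w | exists t, 0 <= t <= T /\ exists n,
          counts (arrival E) t w n /\
          (disc_surplus r x1 p1 (arrival E) sigma n t w < 0 \/
           disc_surplus r x2 p2 (arrival E) sigma n t w < 0)]).

(* overline{F_T}(x) = P{e^{-rV} sigma_1 > x}, V ~ Uniform(0,T] independent of
   sigma_1, i.e. (1/T) * int_{(0,T]} P{sigma_1 > x e^{rv}} dv. *)
Definition FTbar (P : probability Omega R) (r T : R) (sigma1 : Omega -> R) (x : R) : R :=
  T^-1 * fine (\int[lebesgue_measure]_(v in `]0, T])
                 (fine (P [set w | x * expR (r * v) < sigma1 w]))%:E).

End Defs.

Definition slowly_varying {R : realType} (L : R -> R) : Prop :=
  (\forall x \near +oo%R, 0 < L x) /\
  forall a : R, 0 < a -> (L (a * x) / L x) @[x --> +oo%R] --> (1 : R).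

(* Main.v *)
Require Import Defs.
From HB Require Import structures.
From mathcomp Require Import all_boot all_order all_algebra.
From mathcomp Require Import all_classical all_reals all_analysis.
From mathcomp Require Import measurable_realfun ring lra.
Set Implicit Arguments. Unset Strict Implicit. Unset Printing Implicit Defensive.
Import Order.TTheory GRing.Theory Num.Theory.
Import numFieldNormedType.Exports.
Local Open Scope classical_set_scope.
Local Open Scope ring_scope.

(** A single claim causes the ruin. Up to null sets, ruin with initial
    reserves [x1 <= x2] forces the discounted claims arriving before [T] to add
    up to more than [x1]. Either some discounted claim exceeds [(1 - eps) * x1],
    or two of the first [K] claims exceed [eps * x1 / K], which costs a squared
    tail, or more than [K] claims arrive, where Potter's bound on the tail beats
    the geometric decay of the number of arrivals. Conversely a single discounted
    claim above [x1 + p1] causes ruin, and the Bonferroni correction is again a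
    squared tail. The expected number of large discounted claims is compared with
    [lambda * \int_0^T P(sigma > x1 * exp(r v)) dv] over a fine mesh of [0, T]:
    by memorylessness the mean number of arrivals in an interval of length [h]
    lies between [1 - exp(- lambda h)] (up to truncation) and
    [exp(lambda h) - 1], and regular variation makes the tail nearly constant
    over one mesh step. *)

(** * Regularly varying tails and a Potter-type bound *)

Section RegularVariation.
Context {R : realType}.
Variables (alpha : R) (L G : R -> R).
Hypothesis alpha_gt0 : 0 < alpha.
Hypothesis svL : slowly_varying L.
Hypothesis GE : forall x, 0 < x -> G x = L x / x `^ alpha.
Hypothesis G_le1 : forall x, G x <= 1.
Hypothesis G_ge0 : forall x, 0 <= G x.
Hypothesis G_mono : forall x y, 0 < x -> x <= y -> G y <= G x.

(** Slow variation makes [L] positive only near infinity; monotonicity carries positivity of [G]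
    back to every positive point. *)
Lemma tail_gt0 x : 0 < x -> 0 < G x.
Proof.
move=> x0; have [M [Mr HM]] := svL.1.
pose y := Num.max x (M + 1).
have yx : x <= y by rewrite le_max lexx.
have y0 : 0 < y by exact: lt_le_trans yx.
have yM : M < y by rewrite lt_max (ltrDl M 1) ltr01 orbT.
apply: lt_le_trans (G_mono x0 yx).
by rewrite GE // divr_gt0 ?HM // powR_gt0.
Qed.

Lemma tail_ratio_limit c eta : 0 < c -> 0 < eta ->
  exists2 y0, 0 < y0 & forall y, y0 <= y -> G (c * y) <= (c `^ (- alpha) + eta) * G y.
Proof.
move=> c0 eta0.
have ca0 : 0 < c `^ alpha by rewrite powR_gt0.
have e0 : 0 < eta * c `^ alpha by rewrite mulr_gt0.
have lim := svL.2 c c0.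
(* The slack carries the factor c^alpha, so that multiplying by c^-alpha turns it back into
   [eta]. *)
have l1 : 1 < 1 + eta * c `^ alpha by rewrite ltrDl.
have [M1 [M1r HM1]] := cvgr_lt (1 : R) lim _ l1.
have [M2 [M2r HM2]] := svL.1.
exists (Num.max 1 (Num.max (M1 + 1) (M2 + 1))).
  by rewrite lt_max ltr01.
move=> y; rewrite !ge_max => /and3P[y1 yM1 yM2].
have y0 : 0 < y by exact: lt_le_trans y1.
have {}yM1 : M1 < y by apply: lt_le_trans yM1; rewrite ltrDl.
have {}yM2 : M2 < y by apply: lt_le_trans yM2; rewrite ltrDl.
have Ly := HM2 _ yM2.
have := HM1 _ yM1 => /ltW; rewrite ler_pdivrMr // => H.
rewrite !GE ?mulr_gt0 // powRM ?(ltW c0) ?(ltW y0) // powRN.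
have ya0 : 0 < y `^ alpha by rewrite powR_gt0.
rewrite ler_pdivrMr ?mulr_gt0 //.
apply: (le_trans H).
rewrite [leRHS](_ : _ = (1 + eta * c `^ alpha) * L y) //.
by field; rewrite !gt_eqF.
Qed.

(** Regular variation at a single point c < 1 suffices: [G] is nonincreasing, so the bound extends
    uniformly to every larger factor. *)
Lemma tail_near_one eta : 0 < eta ->
  exists c y0, [/\ 0 < c < 1, 0 < y0 &
    forall c' y, c <= c' -> y0 <= y -> G (c' * y) <= (1 + eta) * G y].
Proof.
move=> eta0.
have e2 : 0 < eta / 2 by rewrite divr_gt0.
(* This [c] solves c^-alpha = 1 + eta / 2; the other eta / 2 absorbs the error in the limit. *)
pose c := (1 + eta / 2) `^ (- alpha^-1).
have c0 : 0 < c by rewrite powR_gt0 // addr_gt0.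
have c1 : c < 1.
  rewrite /c powRN invf_lt1 ?powR_gt0 ?addr_gt0 // /powR gt_eqF ?addr_gt0 //.
  by rewrite -[ltLHS]expR0 ltr_expR mulr_gt0 ?invr_gt0 // ln_gt0 // ltrDl.
have [y0 y00 H] := tail_ratio_limit c0 e2.
exists c, y0; split => //; first by rewrite c0.
move=> c' y cc' yy.
have yp : 0 < y by exact: lt_le_trans yy.
apply: (@le_trans _ _ (G (c * y))).
  by rewrite G_mono ?mulr_gt0 // ler_wpM2r // ltW.
apply: (le_trans (H _ yy)); apply: ler_wpM2r => //.
rewrite /c -powRrM mulrNN mulVf ?gt_eqF // powRr1 ?addr_ge0 ?(ltW e2) //.
lra.
Qed.

(** Far out the ratio converges. Below the threshold [y0] the left side is at most 1 while [G y] is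
    at least [G y0], whence the term (G y0)^-1 in the constant. *)
Lemma tail_dominated kappa : 0 < kappa ->
  exists2 A, 0 < A & forall y, 0 < y -> G (kappa * y) <= A * G y.
Proof.
move=> k0.
have [y0 y00 H] := tail_ratio_limit k0 (@ltr01 R).
have Gy0 := tail_gt0 y00.
have ka0 : 0 < kappa `^ (- alpha) by rewrite powR_gt0.
exists (kappa `^ (- alpha) + 1 + (G y0)^-1).
  by rewrite !addr_gt0 ?invr_gt0.
move=> y yp; have [yy|yy] := leP y0 y.
  apply: (le_trans (H _ yy)); apply: ler_wpM2r => //.
  by rewrite lerDl invr_ge0.
apply: (le_trans (G_le1 _)).
apply: (@le_trans _ _ ((G y0)^-1 * G y)); last first.
  by apply: ler_wpM2r => //; rewrite lerDr addr_ge0 // ltW.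
by rewrite ler_pdivlMl // mulr1 G_mono // ltW.
Qed.

(** With t = ln s / (b + 1), raise t n <= exp (t n) to the power b + 1. *)
Lemma pow_le_geometric (s : R) (b : nat) : 1 < s ->
  exists2 A, 0 < A & forall n, n%:R ^+ b.+1 <= A * s ^+ n :> R.
Proof.
move=> s1; have s0 : 0 < s by exact: lt_trans s1.
pose t := ln s / b.+1%:R.
have t0 : 0 < t by rewrite divr_gt0 ?ln_gt0.
exists (t^-1 ^+ b.+1); first by rewrite exprn_gt0 ?invr_gt0.
move=> n; rewrite exprVn ler_pdivlMl ?exprn_gt0 // -exprMn.
apply: (@le_trans _ _ (expR (t * n%:R) ^+ b.+1)).
  apply: lerXn2r; rewrite ?nnegrE ?expR_ge0 //; first by rewrite mulr_ge0 // ltW.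
  by apply: le_trans (expR_ge1Dx _); rewrite lerDr.
rewrite -expRM_natr.
rewrite (_ : t * n%:R * b.+1%:R = ln s * n%:R); last first.
  by rewrite /t; field; rewrite addrC natr1 pnatr_eq0.
by rewrite expRM_natr lnK.
Qed.

(** Each halving of the argument multiplies the tail by at most 2^b, and about log2 n halvings reach
    x / n. The total cost is polynomial in n, hence below geometric growth of any ratio s > 1. *)
Lemma tail_potter s : 1 < s -> exists2 A, 0 < A &
  forall n x, (0 < n)%N -> 0 < x -> n%:R * G (x / n%:R) <= A * s ^+ n * G x.
Proof.
move=> s1.
have h0 : (0 < 2^-1 :> R) by [].
have [A2 A20 HA2] := tail_dominated h0.
have [b Hb] : exists b : nat, A2 <= 2 ^+ b.
  exists (Num.truncn A2).+1.
  apply: (@le_trans _ _ (Num.truncn A2).+1%:R); first by rewrite ltW // truncnS_gt.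
  by rewrite -natrX ler_nat ltnW // ltn_expl.
have iter m x : 0 < x -> G (x / 2 ^+ m) <= (2 ^+ m) ^+ b * G x.
  move=> x0; elim: m => [|m IH]; first by rewrite expr0 expr1n divr1 mul1r.
  have -> : x / 2 ^+ m.+1 = 2^-1 * (x / 2 ^+ m).
    by rewrite exprS invfM mulrCA.
  apply: (le_trans (HA2 _ _)); first by rewrite divr_gt0 // exprn_gt0.
  rewrite exprS exprMn -mulrA; apply: ler_pM => //; exact: ltW.
have [A A0 HA] := pow_le_geometric b s1.
exists (2 ^+ b.+1 * A); first by rewrite mulr_gt0 // exprn_gt0.
move=> n x n0 x0.
(* Here n <= 2^m <= 2n: the first inequality lets m halvings reach x / n, the second keeps their
   cost below (2n)^(b+1). *)
pose m := up_log 2 n.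
have nm : (n <= 2 ^ m)%N by exact: up_logP.
have mn : (2 ^ m <= 2 * n)%N.
  have [n1|n1] := leqP n 1.
    by rewrite /m (_ : n = 1%N) ?up_log1 //; apply/eqP; rewrite eqn_leq n1.
  have /andP[h _] := up_log_bounds (ltnSn 1) n1.
  have m0 : (0 < m)%N by rewrite up_log_gt0.
  by rewrite -(prednK m0) expnS leq_mul2l /= ltnW.
have nr0 : (0 < n%:R :> R) by rewrite ltr0n.
apply: (@le_trans _ _ (n%:R * ((2 ^+ m) ^+ b * G x))).
  apply: ler_wpM2l; first exact: ltW.
  apply: le_trans (iter m _ x0); apply: G_mono.
    by rewrite divr_gt0 // exprn_gt0.
  rewrite ler_wpM2l ?(ltW x0) // ler_pV2 ?inE ?unitfE ?gt_eqF ?exprn_gt0 //.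
  by rewrite -natrX ler_nat.
rewrite mulrA; apply: ler_wpM2r => //.
apply: (@le_trans _ _ ((2 * n%:R) ^+ b.+1)).
  rewrite exprS; apply: ler_pM; rewrite ?exprn_ge0 //.
    by rewrite ler_peMl ?ler1n // ltW.
  by apply: lerXn2r; rewrite ?nnegrE -?natrX -?natrM ?ler0n ?ler_nat.
rewrite exprMn -mulrA; apply: ler_wpM2l; [exact: exprn_ge0 | exact: HA].
Qed.

End RegularVariation.

(** * Real-valued probabilities and independent pairs *)

Section Independence.
Context {R : realType} {d : measure_display} {Omega : measurableType d}.
Variable P : probability Omega R.

Definition pr (A : set Omega) : R := fine (P A).

Lemma prE A : measurable A -> P A = (pr A)%:E.
Proof. by move=> mA; rewrite /pr fineK // fin_num_measure. Qed.

Lemma pr_ge0 A : 0 <= pr A.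
Proof. exact: fine_ge0. Qed.

Lemma pr_le A B : measurable A -> measurable B -> A `<=` B -> pr A <= pr B.
Proof.
by move=> mA mB AB; rewrite -lee_fin -!prE // le_measure ?inE.
Qed.

Lemma prT : pr setT = 1. Proof. by rewrite /pr probability_setT. Qed.

Lemma pr0 : pr set0 = 0. Proof. by rewrite /pr measure0. Qed.

Lemma pr_le1 A : measurable A -> pr A <= 1.
Proof. by move=> mA; rewrite -prT pr_le. Qed.

Lemma prC A : measurable A -> pr (~` A) = 1 - pr A.
Proof.
move=> mA; apply: EFin_inj; rewrite -prE; last exact: measurableC.
by rewrite probability_setC // prE.
Qed.

Lemma pr_disjointU A B : measurable A -> measurable B -> A `&` B = set0 ->
  pr (A `|` B) = pr A + pr B.
Proof.
move=> mA mB AB; apply: EFin_inj; rewrite -prE; last exact: measurableU.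
by rewrite measureU // EFinD -!prE.
Qed.

Lemma pr_leU A B : measurable A -> measurable B -> pr (A `|` B) <= pr A + pr B.
Proof.
move=> mA mB; rewrite -lee_fin EFinD -!prE //; last exact: measurableU.
exact: measureU2.
Qed.

Lemma pr_split A B : measurable A -> measurable B ->
  pr A = pr (A `&` B) + pr (A `&` ~` B).
Proof.
move=> mA mB; rewrite -pr_disjointU -?setIUr ?setUCr ?setIT //.
- exact: measurableI.
- by apply: measurableI => //; exact: measurableC.
- by rewrite setIACA setICr setI0.
Qed.

Lemma pr_bigcup_le (I : Type) (s : seq I) (p : pred I) (F : I -> set Omega) :
  (forall i, measurable (F i)) ->
  pr (\big[setU/set0]_(i <- s | p i) F i) <= \sum_(i <- s | p i) pr (F i).
Proof.
move=> mF; elim: s => [|i s IH]; first by rewrite !big_nil pr0.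
rewrite !big_cons; case: ifP => // _.
apply: (le_trans (pr_leU (mF i) _)); last by rewrite lerD2l.
by apply: bigsetU_measurable => *.
Qed.

Lemma pr_bigcup_nat_le (F : nat -> set Omega) (u : R) :
  (forall i, measurable (F i)) ->
  (forall n, \sum_(i < n) pr (F i) <= u) -> pr (\bigcup_i F i) <= u.
Proof.
move=> mF H; have mU : measurable (\bigcup_i F i) by exact: bigcupT_measurable.
rewrite -lee_fin -prE //.
apply: (le_trans (measure_sigma_subadditive _ mF mU (@subset_refl _ _))).
apply: lime_le; first by apply: is_cvg_nneseries => *; exact: measure_ge0.
apply: nearW => n; rewrite big_mkord.
rewrite (eq_bigr (fun i : 'I_n => (pr (F i))%:E)); last by move=> i _; exact: prE.
rewrite sumEFin lee_fin. exact: H.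
Qed.

(** The part of [A] outside the almost sure event [C] is null; pathwise arguments may thus assume
    positive interarrival times. *)
Lemma pr_as A B C : measurable A -> measurable B -> measurable C -> pr C = 1 ->
  A `&` C `<=` B -> pr A <= pr B.
Proof.
move=> mA mB mC C1 AB; rewrite (pr_split mA mC).
rewrite [X in _ + X](_ : _ = 0) ?addr0.
  by apply: pr_le => //; exact: measurableI.
have mC' := measurableC mC.
apply/eqP; rewrite eq_le pr_ge0 andbT.
apply: le_trans (pr_le (measurableI _ _ mA mC') mC' (@subIsetr _ _ _)) _.
by rewrite prC // C1 subrr.
Qed.

Section PairLaw.
Variables X Y : {mfun Omega >-> R}.

Lemma measurable_pair_preimage (C : set (R * R)) : measurable C ->
  measurable [set w | C (X w, Y w)].
Proof.
move=> mC; rewrite -[X in measurable X]setTI.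
apply: (@measurable_fun_pair _ _ _ _ _ _ X Y) => //; exact: measurable_funPT.
Qed.

(** Restricting [P] to [F] and pushing forward by (X, Y) gives a measure that agrees on rectangles
    with the product of the laws scaled by [pr F]; uniqueness of the product measure settles all
    measurable [C]. *)
Lemma product_law (F : set Omega) (C : set (R * R)) :
  measurable F ->
  (forall A B, measurable A -> measurable B ->
    pr ((X @^-1` A) `&` (Y @^-1` B) `&` F) = pr (X @^-1` A) * pr (Y @^-1` B) * pr F) ->
  measurable C ->
  P ([set w | C (X w, Y w)] `&` F) =
  ((pr F)%:E * \int[distribution P X]_x distribution P Y (xsection C x))%E.
Proof.
move=> mF indep mC.
have mXY : measurable_fun setT (fun w => (X w, Y w)).
  by apply: measurable_fun_pair; exact: measurable_funPT.
pose m1 := mscale (NngNum (pr_ge0 F)) (distribution P X).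
pose m' := measure_function_pushforward__canonical__measure_function_Measure
  (mrestr P mF) mXY.
have := @product_measure_unique _ _ _ _ R m1 (distribution P Y) m' _ C mC.
rewrite /m' /= /pushforward /mrestr => <-.
  rewrite /product_measure1 /m1 ge0_integral_mscale //.
  exact: measurable_fun_xsection.
move=> A B mA mB.
rewrite (_ : _ @^-1` _ = (X @^-1` A) `&` (Y @^-1` B)) //.
have mXA : measurable (X @^-1` A) by exact: measurable_funPTI.
have mYB : measurable (Y @^-1` B) by exact: measurable_funPTI.
rewrite /mscale /= /distribution /pushforward !prE ?indep //.
  by rewrite !EFinM muleC muleA.
by do 2?apply: measurableI.
Qed.

(** [product_law] is applied with [F] and with [setT]; the same integral appears both times, up to
    the factor [pr F]. *)
Lemma pair_indep (F : set Omega) (C : set (R * R)) :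
  measurable F ->
  (forall A B, measurable A -> measurable B ->
    pr ((X @^-1` A) `&` (Y @^-1` B) `&` F) = pr (X @^-1` A) * pr (Y @^-1` B) * pr F) ->
  (forall A B, measurable A -> measurable B ->
    pr ((X @^-1` A) `&` (Y @^-1` B)) = pr (X @^-1` A) * pr (Y @^-1` B)) ->
  measurable C ->
  pr ([set w | C (X w, Y w)] `&` F) = pr [set w | C (X w, Y w)] * pr F.
Proof.
move=> mF indF ind mC; apply: EFin_inj.
have mXY := measurable_pair_preimage mC.
rewrite -prE; last exact: measurableI.
rewrite product_law // EFinM muleC -[in RHS]prE //.
rewrite -[in RHS](setIT [set w | _]) (product_law measurableT _ mC) ?prT ?mul1e //.
by move=> A B mA mB; rewrite setIT mulr1 ind.
Qed.

End PairLaw.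
End Independence.

(** * Partial sums of independent variables *)

Section IndependentSums.
Context {R : realType} {d : measure_display} {Omega : measurableType d}.
Variables (P : probability Omega R) (I : eqType) (Z : I -> Omega -> R) (e : nat -> I).
Hypothesis indep : mutually_independent P Z.
Hypothesis e_inj : injective e.

Definition cylinder (J : seq I) (B : I -> set R) : set Omega :=
  \bigcap_(i in [set i | i \in J]) Z i @^-1` B i.

Definition partial_sum (n : nat) (w : Omega) : R := \sum_(i < n) Z (e i) w.

Lemma measurable_coord i B : measurable B -> measurable (Z i @^-1` B).
Proof. by move=> mB; rewrite -[X in measurable X]setTI; exact: (indep.1 i). Qed.

Lemma measurable_partial_sum n : measurable_fun setT (partial_sum n).
Proof. by apply: measurable_sum => i; exact: indep.1. Qed.

Lemma cylinder_nil B : cylinder [::] B = setT.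
Proof. by rewrite /cylinder; apply/seteqP; split => // w _ i. Qed.

Lemma cylinder_cons j J B : cylinder (j :: J) B = Z j @^-1` B j `&` cylinder J B.
Proof.
apply/seteqP; split => [w H|w [Hj H] i /=].
  by split; [apply: H => /=; rewrite mem_head|move=> i iJ; apply: H; rewrite /= inE iJ orbT].
by rewrite inE => /predU1P[->//|iJ]; exact: H.
Qed.

Lemma measurable_cylinder J B : (forall i, measurable (B i)) -> measurable (cylinder J B).
Proof.
move=> mB; elim: J => [|j J IH]; first by rewrite cylinder_nil.
by rewrite cylinder_cons; apply: measurableI => //; exact: measurable_coord.
Qed.

Lemma pr_cylinder J B : uniq J -> (forall i, measurable (B i)) ->
  pr P (cylinder J B) = \prod_(i <- J) pr P (Z i @^-1` B i).
Proof.
move=> uJ mB; rewrite /pr (indep.2 J B uJ mB).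
elim: J {uJ} => [|j J IH]; first by rewrite !big_nil.
rewrite !big_cons fineM ?IH //; first by rewrite fin_num_measure //; exact: measurable_coord.
elim: J {IH} => [|k J IH]; first by rewrite big_nil.
by rewrite big_cons fin_numM // fin_num_measure //; exact: measurable_coord.
Qed.

Lemma cylinder_update j J B C : j \notin J ->
  cylinder J (fun i => if i == j then C else B i) = cylinder J B.
Proof.
move=> jJ; apply/seteqP; split => w H i /= iJ; have := H i iJ => /=;
  case: eqP => // ij; by rewrite -ij iJ in jJ.
Qed.

Let sumM n : {mfun Omega >-> R} := mfun_Sub (mem_set (measurable_partial_sum n)).
Let coordM i : {mfun Omega >-> R} := mfun_Sub (mem_set (indep.1 i)).

(** The induction on [n] needs an arbitrary cylinder beside the sum: the last summand is first moved
    into it, which makes the shorter sum, the summand and the old cylinder independent; [pair_indep]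
    then handles the event on the full sum. *)
Lemma partial_sum_cylinder n J A B : uniq J -> (forall k, (k < n)%N -> e k \notin J) ->
  (forall i, measurable (B i)) -> measurable A ->
  pr P (partial_sum n @^-1` A `&` cylinder J B) =
  pr P (partial_sum n @^-1` A) * pr P (cylinder J B).
Proof.
elim: n J A B => [|n IH] J A B uJ nJ mB mA.
  have S0 w : partial_sum 0 w = 0 by rewrite /partial_sum big_ord0.
  have [A0|A0] := pselect (A 0).
    have -> : partial_sum 0 @^-1` A = setT.
      by apply/seteqP; split => // w _; rewrite /= S0.
    by rewrite setTI prT mul1r.
  have -> : partial_sum 0 @^-1` A = set0.
    by apply/seteqP; split => // w /=; rewrite S0.
  by rewrite set0I pr0 mul0r.
have mC : measurable [set z : R * R | A (z.1 + z.2)].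
  rewrite -[X in measurable X]setTI.
  by apply: (measurable_funD (measurable_fst) (measurable_snd)).
have -> : partial_sum n.+1 @^-1` A =
    [set w | [set z : R * R | A (z.1 + z.2)] (partial_sum n w, Z (e n) w)].
  by apply/seteqP; split => w /=; rewrite /partial_sum big_ord_recr.
have triple J' B' A' C' : uniq J' -> (forall k, (k < n.+1)%N -> e k \notin J') ->
    (forall i, measurable (B' i)) -> measurable A' -> measurable C' ->
    pr P (partial_sum n @^-1` A' `&` Z (e n) @^-1` C' `&` cylinder J' B') =
    pr P (partial_sum n @^-1` A') * pr P (Z (e n) @^-1` C') * pr P (cylinder J' B').
  move=> uJ' nJ' mB' mA' mC'.
  (* The fresh coordinate [e n] receives the set C', so the event on the last summand becomes part
     of a longer cylinder within reach of the induction hypothesis. *)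
  pose B2 i := if i == e n then C' else B' i.
  have mB2 i : measurable (B2 i) by rewrite /B2; case: ifP.
  have enJ : e n \notin J' by exact: nJ'.
  have E2 : cylinder (e n :: J') B2 = Z (e n) @^-1` C' `&` cylinder J' B'.
    by rewrite cylinder_cons cylinder_update // /B2 eqxx.
  rewrite -setIA -E2 IH //=.
  - rewrite -mulrA pr_cylinder //=; last by rewrite enJ.
    by rewrite big_cons {1}/B2 eqxx -pr_cylinder // cylinder_update.
  - by rewrite enJ.
  - move=> k kn; rewrite inE negb_or nJ' ?(ltnW kn) ?andbT //; last exact: ltnW.
    by apply/eqP => /e_inj kE; rewrite kE ltnn in kn.
apply: (@pair_indep _ _ _ P (sumM n) (coordM (e n))) => //.
- exact: measurable_cylinder.
- by move=> A' C' mA' mC'; exact: triple.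
- move=> A' C' mA' mC'; have := triple [::] B A' C'.
  by rewrite cylinder_nil setIT prT mulr1; apply.
Qed.

Lemma partial_sum_coord n i A B : (forall k, (k < n)%N -> e k <> i) ->
  measurable A -> measurable B ->
  pr P (partial_sum n @^-1` A `&` Z i @^-1` B) =
  pr P (partial_sum n @^-1` A) * pr P (Z i @^-1` B).
Proof.
move=> ni mA mB; have := @partial_sum_cylinder n [:: i] A (fun=> B).
rewrite cylinder_cons cylinder_nil setIT; apply => //.
by move=> k kn; rewrite inE; apply/eqP; exact: ni.
Qed.

Lemma coord_coord i j A B : i != j -> measurable A -> measurable B ->
  pr P (Z i @^-1` A `&` Z j @^-1` B) = pr P (Z i @^-1` A) * pr P (Z j @^-1` B).
Proof.
move=> ij mA mB.
have := @pr_cylinder [:: i; j] (fun k => if k == i then A else B).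
rewrite !cylinder_cons cylinder_nil setIT !big_cons big_nil mulr1 eqxx.
rewrite eq_sym (negbTE ij); apply; first by rewrite /= inE ij.
by move=> k; case: ifP.
Qed.

(** Condition on the partial sum: by independence both probabilities are integrals of section
    probabilities against its law, so sectionwise proportionality integrates. *)
Lemma pair_law_scale n (C1 C2 : set (R * R)) (c : R) : 0 <= c ->
  measurable C1 -> measurable C2 ->
  (forall x, pr P (Z (e n) @^-1` xsection C1 x) = c * pr P (Z (e n) @^-1` xsection C2 x)) ->
  pr P [set w | C1 (partial_sum n w, Z (e n) w)] =
  c * pr P [set w | C2 (partial_sum n w, Z (e n) w)].
Proof.
move=> c0 mC1 mC2 H.
have law C : measurable C -> P [set w | C (partial_sum n w, Z (e n) w)] =
    (\int[distribution P (sumM n)]_x distribution P (coordM (e n)) (xsection C x))%E.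
  move=> mC; have := @product_law _ _ _ P (sumM n) (coordM (e n)) setT C measurableT.
  rewrite setIT prT mul1e; apply => // A B mA mB.
  rewrite setIT mulr1; apply: partial_sum_coord => // k kn /e_inj kE.
  by rewrite kE ltnn in kn.
apply: EFin_inj; rewrite EFinM -!prE; try exact: (measurable_pair_preimage (sumM n) (coordM _)).
rewrite !law // -ge0_integralZl_EFin //; last exact: measurable_fun_xsection.
apply: eq_integral => x _; rewrite /distribution /pushforward /=.
rewrite !prE; try by apply: measurable_coord; exact: measurable_xsection.
by rewrite H EFinM.
Qed.

End IndependentSums.

(** * Measurability of comparison events *)

Section MeasurableComparison.
Context {R : realType} {d : measure_display} {T : measurableType d}.
Variables f g : T -> R.
Hypotheses (mf : measurable_fun setT f) (mg : measurable_fun setT g).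

Lemma measurable_set_le : measurable [set w | f w <= g w].
Proof.
rewrite -[X in measurable X]setTI.
by have H := measurable_fun_ler mf mg; have := H measurableT [set true]; apply.
Qed.

Lemma measurable_set_lt : measurable [set w | f w < g w].
Proof.
rewrite -[X in measurable X]setTI.
by have H := measurable_fun_ltr mf mg; have := H measurableT [set true]; apply.
Qed.

End MeasurableComparison.

(** * Arrivals of the Poisson process *)

Section Poisson.
Context {R : realType} {d : measure_display} {Omega : measurableType d}.
Variables (P : probability Omega R) (I : eqType) (Z : I -> Omega -> R) (e : nat -> I).
Hypothesis indep : mutually_independent P Z.
Hypothesis e_inj : injective e.
Variable lambda : R.
Hypothesis lambda_gt0 : 0 < lambda.
Hypothesis exp_law : forall k t, 0 <= t ->
  P [set w | t < Z (e k) w] = (expR (- (lambda * t)))%:E.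

Local Notation S := (partial_sum Z e).
Local Notation pr := (pr P).
Local Notation mS := (measurable_partial_sum e indep).

(** The almost sure event on which arrival times are strictly increasing. *)
Definition increments_pos : set Omega := \bigcap_k [set w | 0 < Z (e k) w].

Definition exp_cdf (t : R) : R := 1 - expR (- (lambda * t)).

Lemma exp_cdf_ge0 t : 0 <= t -> 0 <= exp_cdf t.
Proof. by move=> t0; rewrite subr_ge0 -[leRHS]expR0 ler_expR oppr_le0 mulr_ge0 // ltW. Qed.

Lemma exp_cdf_lt1 t : exp_cdf t < 1.
Proof. by rewrite gtrDl oppr_lt0 expR_gt0. Qed.

Lemma exp_cdf_mono s t : s <= t -> exp_cdf s <= exp_cdf t.
Proof. by move=> st; rewrite lerD2l lerN2 ler_expR lerN2 ler_wpM2l // ltW. Qed.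

Lemma measurable_exp_gt k t : measurable [set w | t < Z (e k) w].
Proof. by apply: measurable_set_lt; [exact: measurable_cst|exact: indep.1]. Qed.

Lemma pr_exp_gt k t : 0 <= t -> pr [set w | t < Z (e k) w] = expR (- (lambda * t)).
Proof. by move=> t0; apply: EFin_inj; rewrite -prE ?exp_law //; exact: measurable_exp_gt. Qed.

Lemma pr_exp_le k t : 0 <= t -> pr [set w | Z (e k) w <= t] = exp_cdf t.
Proof.
move=> t0; rewrite /exp_cdf -(pr_exp_gt k t0) -prC; last exact: measurable_exp_gt.
by congr pr; apply/seteqP; split => w /=; rewrite leNgt => /negP.
Qed.

Lemma measurable_increments_pos : measurable increments_pos.
Proof. by apply: bigcapT_measurable => k; exact: measurable_exp_gt. Qed.

Lemma pr_increments_pos : pr increments_pos = 1.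
Proof.
have mI := measurable_increments_pos.
have : pr (~` increments_pos) <= 0.
  rewrite setC_bigcap.
  apply: pr_bigcup_nat_le => [k|n].
    by apply: measurableC; exact: measurable_exp_gt.
  rewrite big1 // => k _; rewrite prC ?pr_exp_gt ?mulr0 ?oppr0 ?expR0 ?subrr //.
  exact: measurable_exp_gt.
rewrite prC // => h; apply/eqP; rewrite eq_le pr_le1 //=.
by rewrite -subr_le0.
Qed.

Lemma partial_sumS n w : S n.+1 w = S n w + Z (e n) w.
Proof. by rewrite /partial_sum big_ord_recr. Qed.

Lemma partial_sum0 w : S 0 w = 0.
Proof. by rewrite /partial_sum big_ord0. Qed.

Lemma partial_sum_mono w m n : increments_pos w -> (m <= n)%N -> S m w <= S n w.
Proof.
move=> pw; elim: n => [|n IH]; first by rewrite leqn0 => /eqP->.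
rewrite leq_eqVlt => /predU1P[->//|/IH h].
by rewrite partial_sumS; apply: (le_trans h); rewrite lerDl ltW //; exact: pw.
Qed.

Definition between n (a b : R) : set Omega := [set w | a < S n w] `&` [set w | S n w <= b].

Lemma measurable_S_le n a : measurable [set w | S n w <= a].
Proof. by apply: measurable_set_le; [exact: mS|exact: measurable_cst]. Qed.

Lemma measurable_S_gt n a : measurable [set w | a < S n w].
Proof. by apply: measurable_set_lt; [exact: measurable_cst|exact: mS]. Qed.

Lemma measurable_between n a b : measurable (between n a b).
Proof. by apply: measurableI; [exact: measurable_S_gt|exact: measurable_S_le]. Qed.

(** Given S_n = x <= a, passing [a] means that the next increment exceeds a - x. An exponential
    variable that does so overshoots by at most [h] with probability [exp_cdf h], whatever x is. *)
Lemma memoryless n a h : 0 <= h ->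
  pr ([set w | S n w <= a] `&` between n.+1 a (a + h)) =
  exp_cdf h * pr ([set w | S n w <= a] `&` [set w | a < S n.+1 w]).
Proof.
move=> h0.
pose C1 := [set z : R * R | z.1 <= a] `&`
  ([set z | a < z.1 + z.2] `&` [set z | z.1 + z.2 <= a + h]).
pose C2 := [set z : R * R | z.1 <= a] `&` [set z | a < z.1 + z.2].
have msum : measurable_fun setT (fun z : R * R => z.1 + z.2).
  by apply: measurable_funD; [exact: measurable_fst|exact: measurable_snd].
have m1 : measurable [set z : R * R | z.1 <= a].
  by apply: measurable_set_le; [exact: measurable_fst|exact: measurable_cst].
have m2 : measurable [set z : R * R | a < z.1 + z.2].
  by apply: measurable_set_lt => //; exact: measurable_cst.
have m3 : measurable [set z : R * R | z.1 + z.2 <= a + h].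
  by apply: measurable_set_le => //; exact: measurable_cst.
have mC1 : measurable C1 by apply: measurableI => //; exact: measurableI.
have mC2 : measurable C2 by exact: measurableI.
have -> : [set w | S n w <= a] `&` between n.+1 a (a + h) =
    [set w | C1 (S n w, Z (e n) w)].
  by rewrite /between; apply/seteqP; split => w /=; rewrite partial_sumS.
have -> : [set w | S n w <= a] `&` [set w | a < S n.+1 w] =
    [set w | C2 (S n w, Z (e n) w)].
  by apply/seteqP; split => w /=; rewrite partial_sumS.
apply: (pair_law_scale indep e_inj) => //; first exact: exp_cdf_ge0.
move=> x; rewrite !xsectionE; have [xa|xa] := leP x a; last first.
  have -> : Z (e n) @^-1` (pair x @^-1` C1) = set0.
    by apply/seteqP; split => // w [/=]; rewrite leNgt xa.
  have -> : Z (e n) @^-1` (pair x @^-1` C2) = set0.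
    by apply/seteqP; split => // w [/=]; rewrite leNgt xa.
  by rewrite pr0 mulr0.
have ax : 0 <= a - x by rewrite subr_ge0.
have E2 : Z (e n) @^-1` (pair x @^-1` C2) = [set w | a - x < Z (e n) w].
  apply/seteqP; split => w; rewrite /C2 /= ltrBlDl; first by case.
  by [].
have E1 : Z (e n) @^-1` (pair x @^-1` C1) =
    [set w | a - x < Z (e n) w] `&` ~` [set w | a - x + h < Z (e n) w].
  apply/seteqP; split => w; rewrite /C1 /= ltrBlDl (addrAC a) ltrBlDl => -[].
    by move=> _ [-> h']; split => //; apply/negP; rewrite -leNgt.
  by move=> h1 /negP; rewrite -leNgt.
have ms t := measurable_exp_gt n t.
have := pr_split P (ms (a - x)) (ms (a - x + h)).
rewrite E1 E2 [X in _ = X + _](_ : _ = expR (- (lambda * (a - x + h)))); last first.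
  rewrite -(pr_exp_gt n (addr_ge0 ax h0)); congr pr; apply/seteqP; split => w /= => [[]//|H].
  by split => //; apply: le_lt_trans H; rewrite lerDl.
rewrite !pr_exp_gt // (_ : - (lambda * (a - x + h)) = - (lambda * h) - lambda * (a - x)); last by ring.
rewrite expRD /exp_cdf mulrBl mul1r; lra.
Qed.

(** The summands are the probabilities that level [a] is passed at step n + 1. With positive
    increments this happens only once, and within the first [K] steps exactly when S_K > a. *)
Lemma pr_crossing_sum K a : 0 <= a ->
  \sum_(n < K) pr ([set w | S n w <= a] `&` [set w | a < S n.+1 w]) =
  pr [set w | a < S K w].
Proof.
move=> a0; elim: K => [|K IH].
  rewrite big_ord0 (_ : [set w | _] = set0) ?pr0 //.
  by apply/seteqP; split => // w /=; rewrite partial_sum0 ltNge a0.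
rewrite big_ord_recr /= IH [RHS](pr_split P (measurable_S_gt K.+1 a) (measurable_S_le K a)).
rewrite setIC addrC; congr (_ + _).
have mc : measurable ([set w | a < S K.+1 w] `&` ~` [set w | S K w <= a]).
  by apply: measurableI; [exact: measurable_S_gt|apply: measurableC; exact: measurable_S_le].
have mp := measurable_increments_pos.
apply/eqP; rewrite eq_le; apply/andP; split.
  apply: (pr_as (measurable_S_gt K a) mc mp pr_increments_pos) => w [/= aS pw].
  split; last by apply/negP; rewrite -ltNge.
  by apply: lt_le_trans aS _; exact: partial_sum_mono.
apply: pr_le => //; first exact: measurable_S_gt.
by move=> w [_ /negP]; rewrite /= -ltNge.
Qed.

(** If positive increments add up to at most [t], each is at most [t], and these events are
    independent. *)
Lemma pr_partial_sum_le n t : 0 <= t -> pr [set w | S n w <= t] <= exp_cdf t ^+ n.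
Proof.
move=> t0; elim: n => [|n IH].
  by rewrite expr0 pr_le1 //; exact: measurable_S_le.
have mZ : measurable [set w | Z (e n) w <= t].
  by apply: measurable_set_le; [exact: indep.1|exact: measurable_cst].
apply: (@le_trans _ _ (pr ([set w | S n w <= t] `&` [set w | Z (e n) w <= t]))).
  apply: (pr_as (measurable_S_le n.+1 t) _ measurable_increments_pos pr_increments_pos).
    by apply: measurableI => //; exact: measurable_S_le.
  move=> w [/=]; rewrite partial_sumS => h pw.
  have Sn0 : 0 <= S n w by rewrite -(partial_sum0 w); exact: partial_sum_mono.
  split => /=; apply: le_trans h; first by rewrite lerDl ltW //; exact: pw.
  by rewrite lerDr.
have mle : measurable [set y : R | y <= t].
  by rewrite (_ : [set y | _] = `]-oo, t]%classic) //; apply/seteqP; split => y /=; rewrite in_itv.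
have := @partial_sum_coord _ _ _ P I Z e indep e_inj n (e n) [set y | y <= t] [set y | y <= t].
rewrite /preimage /= => ->//; last by move=> k kn /e_inj kE; rewrite kE ltnn in kn.
by rewrite exprSr pr_exp_le // ler_wpM2r // exp_cdf_ge0.
Qed.

(** Only the first arrival after [a] is counted: it is among the first [K] with probability at least
    1 - exp_cdf T ^ K, and memorylessness gives the chance that it lies within [h] of [a]. *)
Lemma expected_arrivals_ge K a h T : 0 <= a <= T -> 0 <= h ->
  exp_cdf h * (1 - exp_cdf T ^+ K) <= \sum_(n < K) pr (between n.+1 a (a + h)).
Proof.
move=> /andP[a0 aT] h0.
apply: (@le_trans _ _ (exp_cdf h * pr [set w | a < S K w])).
  rewrite ler_wpM2l ?exp_cdf_ge0 //.
  have -> : [set w | a < S K w] = ~` [set w | S K w <= a].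
    by apply/seteqP; split => w /=; rewrite ltNge => /negP.
  rewrite prC ?lerD2l ?lerN2; last exact: measurable_S_le.
  apply: (le_trans (pr_partial_sum_le K a0)).
  by rewrite lerXn2r ?nnegrE ?exp_cdf_ge0 ?exp_cdf_mono //; exact: le_trans aT.
rewrite -pr_crossing_sum // mulr_sumr; apply: ler_sum => n _.
rewrite -memoryless //; apply: pr_le.
- by apply: measurableI; [exact: measurable_S_le|exact: measurable_between].
- exact: measurable_between.
- exact: subIsetr.
Qed.

(** An arrival in the interval either is the first one past [a] or follows, after a gap of at most
    [h], another arrival in the interval. With g = exp_cdf h the sum U satisfies U <= g + g U,
    whence U <= g / (1 - g). *)
Lemma expected_arrivals_le K a h : 0 <= a -> 0 <= h ->
  \sum_(n < K) pr (between n.+1 a (a + h)) <= expR (lambda * h) - 1.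
Proof.
move=> a0 h0; set g := exp_cdf h.
have g0 : 0 <= g by exact: exp_cdf_ge0.
have mpos := measurable_increments_pos.
have step n : pr (between n.+1 a (a + h)) <=
    g * pr ([set w | S n w <= a] `&` [set w | a < S n.+1 w]) + g * pr (between n a (a + h)).
  have mZ : measurable [set w | Z (e n) w <= h].
    by apply: measurable_set_le; [exact: indep.1|exact: measurable_cst].
  rewrite -memoryless //.
  have mle : measurable [set y : R | y <= h].
    by rewrite (_ : [set y | _] = `]-oo, h]%classic) //; apply/seteqP; split => y /=; rewrite in_itv.
  have mbt : measurable [set y : R | a < y <= a + h].
    by rewrite (_ : [set y | _] = `]a, a + h]%classic) //; apply/seteqP; split => y /=; rewrite in_itv.
  have E : between n a (a + h) = S n @^-1` [set y | a < y <= a + h].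
    by apply/seteqP; split => w /=; [move=> [/= -> ->]|move=> /andP[? ?]; split].
  have -> : g * pr (between n a (a + h)) =
      pr (between n a (a + h) `&` [set w | Z (e n) w <= h]).
    rewrite E (partial_sum_coord indep e_inj _ mbt mle) ?pr_exp_le //; first by rewrite mulrC.
    by move=> k kn /e_inj kE; rewrite kE ltnn in kn.
  have mB1 : measurable ([set w | S n w <= a] `&` between n.+1 a (a + h)).
    by apply: measurableI; [exact: measurable_S_le|exact: measurable_between].
  have mB2 : measurable (between n a (a + h) `&` [set w | Z (e n) w <= h]).
    by apply: measurableI => //; exact: measurable_between.
  apply: le_trans (pr_leU P mB1 mB2).
  apply: (pr_as _ _ mpos pr_increments_pos); [exact: measurable_between|exact: measurableU|].
  move=> w [[/= h1 h2] pw]; have [Sa|Sa] := leP (S n w) a; first by left; split => //; split.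
  right; split; first split => //=.
    by apply: le_trans h2; exact: partial_sum_mono.
  move: h2; rewrite /= partial_sumS => h2; rewrite -(lerD2l a).
  by apply: le_trans h2; rewrite lerD2r ltW.
set U := \sum_(n < K) _.
have U1 : U <= g + g * U.
  apply: le_trans (ler_sum _ (fun (n : 'I_K) _ => step n)) _.
  rewrite big_split /= -!mulr_sumr pr_crossing_sum //.
  apply: lerD; first by rewrite ler_piMr // pr_le1 //; exact: measurable_S_gt.
  rewrite ler_wpM2l // /U.
  (* S_0 = 0 does not lie beyond [a], so shifting the index by one loses nothing at the start and
     adds a nonnegative last term. *)
  have B0 : pr (between 0 a (a + h)) = 0.
    rewrite (_ : between _ _ _ = set0) ?pr0 //.
    by apply/seteqP; split => // w [/=]; rewrite partial_sum0 ltNge a0.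
  case: (K) => [|m]; first by rewrite !big_ord0.
  rewrite big_ord_recl B0 add0r [leRHS]big_ord_recr /= lerDl; exact: pr_ge0.
(* Since 1 - g = exp (- lambda h), the quotient g / (1 - g) is exp (lambda h) - 1. *)
have ge : g = 1 - expR (- (lambda * h)) by [].
have ep : 0 < expR (- (lambda * h)) by exact: expR_gt0.
have : U * expR (- (lambda * h)) <= 1 - expR (- (lambda * h)).
  by move: U1; rewrite ge => U1; nra.
rewrite -ler_pdivlMr // mulrBl mul1r divff ?gt_eqF //.
by rewrite -expRN opprK.
Qed.

End Poisson.

(** * Union bound and Bonferroni's lower bound *)

Section Bonferroni.
Context {R : realType} {d : measure_display} {Omega : measurableType d}.
Variables (P : probability Omega R) (F : nat -> set Omega).
Hypothesis mF : forall i, measurable (F i).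

Lemma measurable_finite_union K : measurable (\bigcup_(k in `I_K) F k).
Proof. by apply: bigcup_measurable. Qed.

Lemma pr_finite_union_le K : pr P (\bigcup_(k in `I_K) F k) <= \sum_(k < K) pr P (F k).
Proof. by rewrite bigcup_mkord; exact: pr_bigcup_le. Qed.

(** Adding [F K] loses at most K b by overlap with the earlier union; these losses are rounded up to
    K^2 b. With b = 0 the lemma gives superadditivity for disjoint events. *)
Lemma bonferroni_ge K b : (forall i k, (i < k < K)%N -> pr P (F i `&` F k) <= b) -> 0 <= b ->
  \sum_(k < K) pr P (F k) - K%:R ^+ 2 * b <= pr P (\bigcup_(k in `I_K) F k).
Proof.
move=> + b0; elim: K => [|K IH] H.
  by rewrite big_ord0 expr0n /= mul0r subr0; exact: pr_ge0.
have {}IH : \sum_(k < K) pr P (F k) - K%:R ^+ 2 * b <= pr P (\bigcup_(k in `I_K) F k).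
  by apply: IH => i k /andP[ik kK]; apply: H; rewrite ik ltnS ltnW.
set U := \bigcup_(k in `I_K) F k in IH *.
have mU : measurable U by exact: measurable_finite_union.
have mFU : measurable (F K `&` ~` U) by apply: measurableI => //; exact: measurableC.
have -> : \bigcup_(k in `I_K.+1) F k = U `|` (F K `&` ~` U).
  rewrite IIS bigcup_setU bigcup_set1 setUIr setUv setIT.
  by [].
rewrite pr_disjointU //; last by rewrite setICA setICr setI0.
rewrite big_ord_recr /= (pr_split P (mF K) mU).
have HU : pr P (F K `&` U) <= K%:R * b.
  rewrite setIC /U setI_bigcupl.
  apply: (@le_trans _ _ (\sum_(i < K) pr P (F i `&` F K))).
    rewrite bigcup_mkord; apply: pr_bigcup_le => i; exact: measurableI.
  apply: (@le_trans _ _ (\sum_(i < K) b)).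
    by apply: ler_sum => i _; apply: H; rewrite ltn_ord ltnSn.
  by rewrite sumr_const card_ord mulr_natl.
have bK : 0 <= (K%:R + 1) * b by rewrite mulr_ge0 // addr_ge0.
rewrite -natr1; move: IH HU bK; set u := pr P U; set v := pr P (F K `&` U); nra.
Qed.

End Bonferroni.

(** * The ruin event along a path *)

Section RuinEvent.
Context {R : realType} {d : measure_display} {Omega : measurableType d}.
Variables (P : probability Omega R) (E sigma : nat -> Omega -> R).
Variables (r T : R).
Hypothesis indep : mutually_independent P (claim_family E sigma).
Hypotheses (r_gt0 : 0 < r) (T_gt0 : 0 < T).

Local Notation theta := (arrival E).
Local Notation S := (partial_sum (claim_family E sigma) inl).

Definition ruin (p1 p2 x1 x2 : R) : set Omega :=
  [set w | exists t, 0 <= t <= T /\ exists n,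
     counts theta t w n /\
     (disc_surplus r x1 p1 theta sigma n t w < 0 \/
      disc_surplus r x2 p2 theta sigma n t w < 0)].

(* Earliest nonnegative time by which the first n arrivals have occurred. *)
Fixpoint last_arrival (n : nat) (w : Omega) : R :=
  if n is m.+1 then Num.max (last_arrival m w) (theta m w) else 0.

Lemma last_arrival_le n w t :
  last_arrival n w <= t <-> 0 <= t /\ forall k, (k < n)%N -> theta k w <= t.
Proof.
elim: n => [|n IH] /=; first by split => [->//|[]].
rewrite ge_max; split.
  move=> /andP[/IH[t0 H] tn]; split=> // k; rewrite ltnS leq_eqVlt.
  by move=> /predU1P[->//|]; exact: H.
move=> [t0 H]; rewrite H // andbT; apply/IH; split=> // k kn.
by apply: H; rewrite ltnS ltnW.
Qed.

Lemma disc_surplus_mono x p n s t w : 0 <= p -> s <= t ->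
  disc_surplus r x p theta sigma n s w <= disc_surplus r x p theta sigma n t w.
Proof.
move=> p0 st; rewrite /disc_surplus lerD2r lerD2l ler_wpM2l // lerD2l lerN2.
by rewrite ler_expR lerN2 ler_wpM2l // ltW.
Qed.

Lemma measurable_claim k : measurable_fun setT (sigma k).
Proof. exact: (indep.1 (inr k)). Qed.

Lemma measurable_arrival k : measurable_fun setT (theta k).
Proof. by apply: measurable_sum => i; exact: (indep.1 (inl (nat_of_ord i))). Qed.

Lemma measurable_last_arrival n : measurable_fun setT (last_arrival n).
Proof.
elim: n => [|n IH] /=; first exact: measurable_cst.
exact: (measurable_maxr IH (measurable_arrival n)).
Qed.

Lemma measurable_discount (f : Omega -> R) : measurable_fun setT f ->
  measurable_fun setT (fun w => expR (- (r * f w))).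
Proof.
move=> mf; apply: (measurableT_comp (@measurable_expR R)).
apply: measurable_funN.
exact: (measurable_funM (measurable_cst r) mf).
Qed.

Lemma measurable_surplus x p n :
  measurable_fun setT (fun w => disc_surplus r x p theta sigma n (last_arrival n w) w).
Proof.
apply: measurable_funB.
  apply: (measurable_funD (measurable_cst x)).
  apply: (measurable_funM (measurable_cst p)).
  apply: (measurable_funB (measurable_cst (1 : R))).
  apply: measurable_discount; exact: measurable_last_arrival.
apply: measurable_sum => k; apply: measurable_funM; last exact: measurable_claim.
apply: measurable_discount; exact: measurable_arrival.
Qed.

(* Between claims the surplus is nondecreasing, so the existential over t is
   decided at the last arrival time. *)
Lemma ruinE p1 p2 x1 x2 : 0 <= p1 -> 0 <= p2 -> ruin p1 p2 x1 x2 =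
  \bigcup_n ([set w | last_arrival n w <= T] `&` [set w | last_arrival n w < theta n w] `&`
    ([set w | disc_surplus r x1 p1 theta sigma n (last_arrival n w) w < 0] `|`
     [set w | disc_surplus r x2 p2 theta sigma n (last_arrival n w) w < 0])).
Proof.
move=> p10 p20; apply/seteqP; split => w /=.
  move=> [t [/andP[t0 tT] [n [[tn nt] H]]]]; exists n => //.
  have tau : last_arrival n w <= t by apply/last_arrival_le.
  split; first by split; [exact: le_trans tT|exact: le_lt_trans nt].
  by case: H => H; [left|right]; apply: le_lt_trans H; exact: disc_surplus_mono.
move=> [n _ [[tT tn] H]]; exists (last_arrival n w).
have [t0 tk] := (last_arrival_le n w _).1 (lexx _).
by split; [rewrite t0|exists n].
Qed.

(** [ruinE] turns the uncountable existential over times into a countable union. *)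
Lemma measurable_ruin p1 p2 x1 x2 : 0 <= p1 -> 0 <= p2 -> measurable (ruin p1 p2 x1 x2).
Proof.
move=> p10 p20; rewrite ruinE //; apply: bigcupT_measurable => n.
have mt := measurable_last_arrival n.
apply: measurableI; first apply: measurableI.
- by apply: measurable_set_le => //; exact: measurable_cst.
- by apply: measurable_set_lt => //; exact: measurable_arrival.
- by apply: measurableU; apply: measurable_set_lt;
    [exact: measurable_surplus|exact: measurable_cst|exact: measurable_surplus|exact: measurable_cst].
Qed.

Local Notation Pos := (increments_pos (claim_family E sigma) inl).

Lemma arrival_mono w i k : Pos w -> (i <= k)%N -> theta i w <= theta k w.
Proof. by move=> pw ik; apply: (partial_sum_mono (e:=inl) pw); rewrite ltnS. Qed.

Lemma arrival_gt0 w k : Pos w -> 0 < theta k w.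
Proof.
move=> pw; apply: lt_le_trans (arrival_mono pw (leq0n k)).
by rewrite /arrival big_ord1; exact: (pw 0%N I).
Qed.

Lemma arrival_lt w k : Pos w -> theta k w < theta k.+1 w.
Proof. by move=> pw; rewrite /arrival [ltRHS]big_ord_recr /= ltrDl; exact: (pw k.+1 I). Qed.

Hypothesis sigma_ge0 : forall k w, 0 <= sigma k w.

Lemma discounted_claim_le k w : Pos w ->
  expR (- (r * theta k w)) * sigma k w <= sigma k w.
Proof.
move=> pw; rewrite ler_piMl // -[leRHS]expR0 ler_expR oppr_le0.
by rewrite mulr_ge0 ?(ltW r_gt0) // ltW // arrival_gt0.
Qed.

(** Premium income is nonnegative, so ruin of either component needs claims above its reserve, hence
    above the common lower bound [x]. *)
Lemma ruin_large_claims p1 p2 x1 x2 x w : 0 <= p1 -> 0 <= p2 -> 0 < x ->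
  x <= x1 -> x <= x2 -> Pos w -> ruin p1 p2 x1 x2 w ->
  exists n, (forall k, (k < n)%N -> theta k w <= T) /\
    x < \sum_(k < n) expR (- (r * theta k w)) * sigma k w.
Proof.
move=> p10 p20 x0 xx1 xx2 pw [t [/andP[t0 tT] [n [[tn nt] H]]]].
exists n; split=> [k kn|]; first exact: le_trans (tn k kn) tT.
have ft : 0 <= 1 - expR (- (r * t)).
  by rewrite subr_ge0 -[leRHS]expR0 ler_expR oppr_le0 mulr_ge0 // ltW.
case: H; rewrite /disc_surplus subr_lt0; apply: le_lt_trans.
  by apply: (le_trans xx1); rewrite lerDl mulr_ge0.
by apply: (le_trans xx2); rewrite lerDl mulr_ge0.
Qed.

(** Discounted premium income never exceeds [p1] and the other claims are nonnegative, so one such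
    claim already ruins the first component. *)
Lemma large_claim_ruin p1 p2 x1 x2 k w : 0 <= p1 -> 0 <= x1 -> Pos w -> theta k w <= T ->
  x1 + p1 < expR (- (r * theta k w)) * sigma k w -> ruin p1 p2 x1 x2 w.
Proof.
move=> p10 x10 pw kT H; exists (theta k w); split.
  by rewrite kT andbT ltW // arrival_gt0.
(* Arrivals are indexed from 0, and the claim at time [theta k] is already counted at that time. *)
exists k.+1; split.
  by split=> [i ik|]; [exact: arrival_mono|exact: arrival_lt].
left; rewrite /disc_surplus subr_lt0.
apply: (@le_lt_trans _ _ (x1 + p1)).
  by rewrite lerD2l ler_piMr // gerBl expR_ge0.
apply: (lt_le_trans H); rewrite big_ord_recr /= lerDr sumr_ge0 // => i _.
by rewrite mulr_ge0 // expR_ge0.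
Qed.

End RuinEvent.

Lemma mesh_locate {R : realType} (h t : R) (m : nat) : 0 < t -> t <= m%:R * h ->
  exists j, [/\ (j < m)%N, j%:R * h < t & t <= j%:R * h + h].
Proof.
move=> t0; elim: m => [|m IH] tm; first by move: t0; rewrite ltNge (le_trans tm) ?mul0r.
have [/IH[j [jm h1 h2]]|mt] := leP t (m%:R * h); first by exists j; rewrite ltnS ltnW.
by exists m; split => //; rewrite -natr1 mulrDl mul1r in tm.
Qed.

(** * Two-sided bounds for the ruin probability *)

Section RuinBounds.
Context {R : realType} {d : measure_display} {Omega : measurableType d}.
Variables (P : probability Omega R) (E sigma : nat -> Omega -> R) (G : R -> R).
Variables (r T lambda : R).
Hypothesis indep : mutually_independent P (claim_family E sigma).
Hypotheses (r_gt0 : 0 < r) (T_gt0 : 0 < T) (lambda_gt0 : 0 < lambda).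
Hypothesis exp_law : forall k t, 0 <= t -> P [set w | t < E k w] = (expR (- (lambda * t)))%:E.
Hypothesis sigma_ge0 : forall k w, 0 <= sigma k w.
Hypothesis claim_tail : forall k y, 0 < y -> P [set w | y < sigma k w] = (G y)%:E.

Local Notation S := (partial_sum (claim_family E sigma) inl).
Local Notation btw := (between (claim_family E sigma) inl).
Local Notation Pos := (increments_pos (claim_family E sigma) inl).

Let inl_inj : injective (@inl nat nat). Proof. by move=> ? ? []. Qed.

Lemma pr_claim k y : 0 < y -> pr P [set w | y < sigma k w] = G y.
Proof. by move=> y0; rewrite /pr claim_tail. Qed.

Lemma measurable_claim_gt k y : measurable [set w | y < sigma k w].
Proof. by apply: measurable_set_lt; [exact: measurable_cst|exact: (measurable_claim indep)]. Qed.

Let measurable_gt (y : R) : measurable [set u : R | y < u].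
Proof.
by rewrite (_ : [set u | _] = `]y, +oo[%classic) //; apply/seteqP; split => u /=; rewrite in_itv /= andbT.
Qed.

Lemma pr_between_claim n k a b y : 0 < y ->
  pr P (btw n a b `&` [set w | y < sigma k w]) = pr P (btw n a b) * G y.
Proof.
move=> y0; have mbt : measurable [set u : R | a < u <= b].
  by rewrite (_ : [set u | _] = `]a, b]%classic) //; apply/seteqP; split => u /=; rewrite in_itv.
have -> : btw n a b = S n @^-1` [set u | a < u <= b].
  by apply/seteqP; split => w /=; [move=> [/= -> ->]|move=> /andP[? ?]; split].
rewrite -(pr_claim k y0).
by apply: (partial_sum_coord indep inl_inj (i := inr k) _ mbt (measurable_gt y)).
Qed.

Lemma pr_arrived_claim n k t y : 0 < y ->
  pr P ([set w | S n w <= t] `&` [set w | y < sigma k w]) = pr P [set w | S n w <= t] * G y.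
Proof.
move=> y0; have mle : measurable [set u : R | u <= t].
  by rewrite (_ : [set u | _] = `]-oo, t]%classic) //; apply/seteqP; split => u /=; rewrite in_itv.
rewrite -(pr_claim k y0).
by apply: (partial_sum_coord indep inl_inj (i := inr k) _ mle (measurable_gt y)).
Qed.

Lemma pr_two_claims i k y : i != k -> 0 < y ->
  pr P ([set w | y < sigma i w] `&` [set w | y < sigma k w]) = G y ^+ 2.
Proof.
move=> ik y0; rewrite expr2 -{1}(pr_claim i y0) -(pr_claim k y0).
have ij : (inr i : nat + nat) != inr k by [].
exact: (coord_coord indep ij (measurable_gt y) (measurable_gt y)).
Qed.

Section Upper.
Variables (p1 p2 x1 x2 x eps : R) (K m : nat).
Hypotheses (p1_ge0 : 0 <= p1) (p2_ge0 : 0 <= p2) (x_gt0 : 0 < x) (xx1 : x <= x1) (xx2 : x <= x2).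
Hypotheses (eps_gt0 : 0 < eps) (eps_lt1 : eps < 1) (K_gt0 : (0 < K)%N) (m_gt0 : (0 < m)%N).

Let h : R := T / m%:R.
Let h_ge0 : 0 <= h. Proof. by rewrite divr_ge0 // ltW. Qed.

(** The threshold sits at the left end of the mesh cell, where discounting is weakest, so that the
    event covers every arrival time in the cell. *)
Let big k j : set Omega := btw k.+1 (j%:R * h) (j%:R * h + h) `&`
  [set w | (1 - eps) * x * expR (r * (j%:R * h)) < sigma k w].
(** The diagonal is made empty so that unions can run over all pairs of indices. *)
Let two i k : set Omega := if i == k then set0 else
  [set w | eps * x / K%:R < sigma i w] `&` [set w | eps * x / K%:R < sigma k w].
Let many n : set Omega :=
  \bigcup_(k in `I_n) ([set w | S n w <= T] `&` [set w | x / n%:R < sigma k w]).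

(** The small terms, at most [K] of them, contribute at most eps * x together. An index [k0] beyond
    the range encodes that no term is large. *)
Lemma sum_le_one_large n (f : nat -> R) (k0 : nat) (b : R) : (n <= K)%N -> 0 <= b ->
  ((k0 < n)%N -> f k0 <= b) -> (forall k, (k < n)%N -> k != k0 -> f k <= eps * x / K%:R) ->
  \sum_(k < n) f k <= b + eps * x.
Proof.
move=> nK b0 fk0 H.
have ex0 : 0 <= eps * x / K%:R by rewrite divr_ge0 // ltW // mulr_gt0.
apply: (@le_trans _ _ (\sum_(k < n) ((if k == k0 :> nat then b else 0) + eps * x / K%:R))).
  apply: ler_sum => k _; case: eqP => [kk|/eqP kk].
    by rewrite kk; apply: (le_trans (fk0 _)); rewrite -?kk ?lerDl.
  by rewrite add0r H.
rewrite big_split /=; apply: lerD.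
  rewrite -big_mkcond /=; have [k0n|k0n] := ltnP k0 n.
    by rewrite (big_pred1 (Ordinal k0n)).
  rewrite big1 // => i /eqP ik; move: (ltn_ord i); rewrite ik ltnNge k0n //.
rewrite sumr_const card_ord. rewrite -(mulr_natr _ n) -(mulrA (eps * x)) ler_piMr ?mulr_ge0 ?(ltW eps_gt0) ?(ltW x_gt0) //.
by rewrite ler_pdivrMl ?ltr0n // mulr1 ler_nat.
Qed.

(** Let n be the number of claims at ruin. For n > K, pigeonhole gives a claim above x / n. For n <=
    K, a path outside [big] and [two] has one discounted claim of at most (1 - eps) x and all others
    at most eps x / K, so the total cannot exceed x. *)
Lemma ruin_cover w : Pos w -> ruin E sigma r T p1 p2 x1 x2 w ->
  (\bigcup_(k in `I_K) \bigcup_(j in `I_m) big k j `|`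
   \bigcup_(i in `I_K) \bigcup_(k in `I_K) two i k `|`
   \bigcup_i many (K.+1 + i)) w.
Proof.
move=> pw rw.
have [n [nT xs]] := ruin_large_claims r_gt0 p1_ge0 p2_ge0 x_gt0 xx1 xx2 pw rw.
have mh : m%:R * h = T by rewrite /h mulrC divfK // pnatr_eq0 -lt0n.
have [nK|Kn] := leqP n K; last first.
  right; exists (n - K.+1)%N => //; rewrite subnKC //.
  have n0 : (0 < n)%N by exact: leq_trans Kn.
  have [[k [kn kx]]|none] := pselect (exists k, (k < n)%N /\ x / n%:R < sigma k w).
    exists k => //; split=> //=.
    by rewrite -(prednK n0); apply: nT; rewrite prednK.
  exfalso; move: xs; apply/negP; rewrite -leNgt.
  apply: (@le_trans _ _ (\sum_(k < n) x / n%:R)).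
    apply: ler_sum => k _; apply: (le_trans (discounted_claim_le r_gt0 sigma_ge0 k pw)).
    by rewrite leNgt; apply/negP => kx; apply: none; exists k.
  by rewrite sumr_const card_ord -[leLHS]mulr_natr divfK // pnatr_eq0 -lt0n.
left; have [[k [kn kbig]]|nobig] := pselect (exists k, (k < n)%N /\
    (1 - eps) * x < expR (- (r * arrival E k w)) * sigma k w).
  left; exists k; first exact: leq_trans kn nK.
  have th0 := arrival_gt0 k pw.
  have thT := nT k kn; rewrite -mh in thT.
  have [j [jm j1 j2]] := mesh_locate th0 thT.
  exists j => //; split; first by split.
  rewrite expRN [ltRHS]mulrC ltr_pdivlMr ?expR_gt0 // in kbig.
  apply: le_lt_trans kbig; rewrite ler_wpM2l ?mulr_ge0 ?(ltW x_gt0) //.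
    by rewrite subr_ge0 ltW.
  by rewrite ler_expR ler_wpM2l // ltW.
right; have [[i [k [iK kK ik hi hk]]]|notwo] := pselect (exists i k,
    [/\ (i < K)%N, (k < K)%N, i != k, eps * x / K%:R < sigma i w & eps * x / K%:R < sigma k w]).
  by exists i => //; exists k => //; rewrite /two (negbTE ik).
exfalso.
have [k0 Hk0] : exists k0, forall k, (k < n)%N -> k != k0 -> sigma k w <= eps * x / K%:R.
  have [[k0 [k0n h0]]|none] := pselect (exists k0, (k0 < n)%N /\ eps * x / K%:R < sigma k0 w).
    exists k0 => k kn kk0; rewrite leNgt; apply/negP => hk; apply: notwo.
    by exists k, k0; split => //; exact: leq_trans nK.
  by exists n => k kn _; rewrite leNgt; apply/negP => hk; apply: none; exists k.
move: xs; apply/negP; rewrite -leNgt.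
have -> : x = (1 - eps) * x + eps * x by ring.
apply: (sum_le_one_large (k0 := k0) (f := fun k => expR (- (r * arrival E k w)) * sigma k w)) => //.
- by rewrite mulr_ge0 ?(ltW x_gt0) // subr_ge0 ltW.
- by move=> k0n; rewrite leNgt; apply/negP => hb; apply: nobig; exists k0.
- move=> k kn kk0; apply: le_trans (Hk0 k kn kk0).
  exact: discounted_claim_le.
Qed.

Let y_gt0 j : 0 < (1 - eps) * x * expR (r * (j%:R * h)).
Proof. by rewrite !mulr_gt0 ?expR_gt0 // subr_gt0. Qed.

Let z_gt0 : 0 < eps * x / K%:R.
Proof. by rewrite divr_gt0 ?mulr_gt0 ?ltr0n. Qed.

Let measurable_big k j : measurable (big k j).
Proof. by apply: measurableI; [exact: (measurable_between inl indep)|exact: measurable_claim_gt]. Qed.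

Let measurable_two i k : measurable (two i k).
Proof.
rewrite /two; case: eqP => // _.
by apply: measurableI; exact: measurable_claim_gt.
Qed.

Let measurable_many_part n k :
  measurable ([set w | S n w <= T] `&` [set w | x / n%:R < sigma k w]).
Proof. by apply: measurableI; [exact: (measurable_S_le inl indep)|exact: measurable_claim_gt]. Qed.

Let measurable_many n : measurable (many n).
Proof. exact: measurable_finite_union. Qed.

Lemma pr_many_le n : (0 < n)%N ->
  pr P (many n) <= exp_cdf lambda T ^+ n * (n%:R * G (x / n%:R)).
Proof.
move=> n0; apply: (le_trans (pr_finite_union_le P (measurable_many_part n) n)).
have xn0 : 0 < x / n%:R by rewrite divr_gt0 ?ltr0n.
apply: (@le_trans _ _ (\sum_(k < n) exp_cdf lambda T ^+ n * G (x / n%:R))).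
  apply: ler_sum => k _; rewrite pr_arrived_claim // ler_wpM2r //.
    by rewrite -(pr_claim 0 xn0) pr_ge0.
  by apply: (pr_partial_sum_le indep inl_inj lambda_gt0); [exact: exp_law|exact: ltW].
by rewrite sumr_const card_ord -[leLHS]mulr_natl mulrCA.
Qed.

(** Union bound over the cover of [ruin_cover]. The contribution of more than [K] claims stays
    abstract as a bound [c] on partial sums, to be supplied by Potter's bound. *)
Lemma ruin_upper c :
  (forall N, \sum_(i < N) exp_cdf lambda T ^+ (K.+1 + i) *
     ((K.+1 + i)%:R * G (x / (K.+1 + i)%:R)) <= c) ->
  pr P (ruin E sigma r T p1 p2 x1 x2) <=
    (expR (lambda * h) - 1) * \sum_(j < m) G ((1 - eps) * x * expR (r * (j%:R * h)))
    + K%:R ^+ 2 * G (eps * x / K%:R) ^+ 2 + c.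
Proof.
move=> Hc.
set A := \bigcup_(k in `I_K) \bigcup_(j in `I_m) big k j.
set B := \bigcup_(i in `I_K) \bigcup_(k in `I_K) two i k.
set C := \bigcup_i many (K.+1 + i).
have mAk k : measurable (\bigcup_(j in `I_m) big k j) by exact: measurable_finite_union.
have mBk k : measurable (\bigcup_(j in `I_K) two k j) by exact: measurable_finite_union.
have mA : measurable A by exact: measurable_finite_union.
have mB : measurable B by exact: measurable_finite_union.
have mC : measurable C by exact: bigcupT_measurable.
have mAB : measurable (A `|` B) by exact: measurableU.
have mpos := measurable_increments_pos inl indep.
have ppos : pr P Pos = 1 by apply: (pr_increments_pos indep); exact: exp_law.
apply: (@le_trans _ _ (pr P (A `|` B `|` C))).
  apply: (pr_as _ _ mpos ppos); first exact: (measurable_ruin T indep r_gt0).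
    exact: measurableU.
  by move=> w [rw pw]; exact: ruin_cover.
apply: (le_trans (pr_leU P mAB mC)); apply: lerD; last first.
  apply: pr_bigcup_nat_le => // N; apply: le_trans (Hc N).
  by apply: ler_sum => i _; exact: pr_many_le.
apply: (le_trans (pr_leU P mA mB)); apply: lerD.
  apply: (le_trans (pr_finite_union_le P mAk K)).
  apply: (@le_trans _ _ (\sum_(k < K) \sum_(j < m) pr P (big k j))).
    by apply: ler_sum => k _; exact: pr_finite_union_le.
  (* With the cell fixed, the arrival probabilities over k add up to a truncated mean number of
     arrivals in that cell. *)
  rewrite exchange_big /= mulr_sumr; apply: ler_sum => j _.
  under eq_bigr do rewrite pr_between_claim //.
  rewrite -mulr_suml ler_wpM2r //; first by rewrite -(pr_claim 0 (y_gt0 j)) pr_ge0.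
  apply: (expected_arrivals_le indep inl_inj lambda_gt0) => //; exact: mulr_ge0.
apply: (le_trans (pr_finite_union_le P mBk K)).
apply: (@le_trans _ _ (\sum_(i < K) \sum_(k < K) G (eps * x / K%:R) ^+ 2)).
  apply: ler_sum => i _; apply: (le_trans (pr_finite_union_le P (measurable_two i) K)).
  apply: ler_sum => k _; rewrite /two; case: eqP => [_|/eqP ik].
    by rewrite pr0 sqr_ge0.
  by rewrite pr_two_claims.
by rewrite !sumr_const !card_ord -mulrnA -[leLHS]mulr_natl natrM expr2.
Qed.

End Upper.

(** Thresholds now sit at the right end of each cell, so that each event forces ruin. Bonferroni is
    used twice: over the arrival index, at the cost of squared tails, and over the disjoint cells,
    at no cost. *)
Lemma ruin_lower p1 p2 x1 x2 K m : 0 <= p1 -> 0 <= p2 -> 0 < x1 -> (0 < m)%N ->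
  exp_cdf lambda (T / m%:R) * (1 - exp_cdf lambda T ^+ K) *
    \sum_(j < m) G ((x1 + p1) * expR (r * (j%:R * (T / m%:R) + T / m%:R))) - K%:R ^+ 2 * G x1 ^+ 2 <=
  pr P (ruin E sigma r T p1 p2 x1 x2).
Proof.
move=> p10 p20 x10 m0; set h := T / m%:R.
have h0 : 0 <= h by rewrite divr_ge0 // ltW.
have mh : m%:R * h = T by rewrite /h mulrC divfK // pnatr_eq0 -lt0n.
pose y j := (x1 + p1) * expR (r * (j%:R * h + h)).
have xp0 : 0 < x1 + p1 by rewrite ltr_wpDr.
have y0 j : 0 < y j by rewrite mulr_gt0 ?expR_gt0.
have xy j : x1 <= y j.
  apply: (@le_trans _ _ (x1 + p1)); first by rewrite lerDl.
  rewrite ler_peMr ?(ltW xp0) // -[leLHS]expR0 ler_expR mulr_ge0 ?(ltW r_gt0) //.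
  by rewrite addr_ge0 // mulr_ge0.
pose D k j := btw k.+1 (j%:R * h) (j%:R * h + h) `&` [set w | y j < sigma k w].
have mD k j : measurable (D k j).
  by apply: measurableI; [exact: (measurable_between inl indep)|exact: measurable_claim_gt].
pose U k := \bigcup_(j in `I_m) D k j.
have mU k : measurable (U k) by exact: measurable_finite_union.
have mpos := measurable_increments_pos inl indep.
have ppos : pr P Pos = 1 by apply: (pr_increments_pos indep); exact: exp_law.
apply: (@le_trans _ _ (pr P (\bigcup_(k in `I_K) U k))); last first.
  apply: (pr_as _ _ mpos ppos); first exact: measurable_finite_union.
    exact: (measurable_ruin T indep r_gt0).
  move=> w [[k kK [j /= jm [[/= S1 S2] yk]]] pw].
  have Sh : arrival E k w <= j%:R * h + h by exact: S2.
  apply: (large_claim_ruin sigma_ge0 p2 x2 (k := k)) => //; first exact: ltW.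
    apply: (le_trans Sh); rewrite -mh -[X in _ + X]mul1r -mulrDl ler_wpM2r //.
    by rewrite natr1 ler_nat.
  rewrite expRN [ltRHS]mulrC ltr_pdivlMr ?expR_gt0 //.
  apply: le_lt_trans yk; rewrite /y ler_wpM2l ?(ltW xp0) // ler_expR ler_wpM2l //.
  exact: ltW.
(* Every threshold is at least [x1], so two of these events together need two independent claims
   above [x1]. *)
apply: le_trans (bonferroni_ge mU (b := G x1 ^+ 2) _ (sqr_ge0 _)); last first.
  move=> i k /andP[ik _]; rewrite -(@pr_two_claims i k) //; last by rewrite ltn_eqF.
  apply: pr_le; [exact: measurableI|by apply: measurableI; exact: measurable_claim_gt|].
  move=> w [[j _ [_ /= h1]] [j' _ [_ /= h2]]].
  by split => /=; [apply: le_lt_trans h1|apply: le_lt_trans h2].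
rewrite lerD2r.
apply: (@le_trans _ _ (\sum_(k < K) \sum_(j < m) pr P (D k j))); last first.
  apply: ler_sum => k _.
  have := bonferroni_ge (P := P) (mD k) (K := m) (b := 0).
  rewrite mulr0 subr0; apply => // i j /andP[ij _].
  rewrite (_ : _ `&` _ = set0) ?pr0 //.
  apply/seteqP; split => // w [[[/= _ a1] _] [[/= a2 _] _]].
  have := lt_le_trans a2 a1; rewrite -[X in _ + X]mul1r -mulrDl ltNge ler_wpM2r //.
  by rewrite natr1 ler_nat.
rewrite exchange_big /= mulr_sumr; apply: ler_sum => j _.
under eq_bigr do rewrite pr_between_claim //.
rewrite -mulr_suml ler_wpM2r //; first by rewrite -(pr_claim 0 (y0 j)) pr_ge0.
apply: (expected_arrivals_ge indep inl_inj lambda_gt0) => //.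
rewrite mulr_ge0 //= -mh ler_wpM2r // ler_nat; exact: ltnW.
Qed.

End RuinBounds.

(** * Riemann sums of a nonincreasing function *)

Section RiemannSums.
Context {R : realType}.
Variable f : R -> R.
Hypothesis f_mono : forall u v, u <= v -> f v <= f u.
Hypothesis f_ge0 : forall u, 0 <= f u.

Local Notation mu := (@lebesgue_measure R).

Let measurable_f D : measurable D -> measurable_fun D (fun v => (f v)%:E).
Proof.
move=> mD; apply/measurable_EFinP; apply: nonincreasing_measurable => // u v; exact: f_mono.
Qed.

Lemma integral_strip a h : 0 <= h ->
  ((h * f (a + h))%:E <= \int[mu]_(v in `]a, (a + h)%R]) (f v)%:E <= (h * f a)%:E)%E.
Proof.
move=> h0.
have mI : measurable `]a, (a + h)%R]%classic by exact: measurable_itv.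
have len (c : R) : (\int[mu]_(v in `]a, (a + h)%R]) (cst c%:E v) = (h * c)%:E)%E.
  rewrite integral_cst //= lebesgue_measure_itv /= lte_fin ltrDl.
  case: ltP => [hp|hn]; first by rewrite -EFinD -EFinM addrAC subrr add0r mulrC.
  have -> : h = 0 by apply/eqP; rewrite eq_le h0 hn.
  by rewrite mule0 mul0r.
apply/andP; split; rewrite -len; apply: ge0_le_integral => //=.
- by move=> v _; rewrite lee_fin.
- exact: measurable_f.
- by move=> v; rewrite in_itv /= => /andP[_ vh]; rewrite lee_fin f_mono.
- by move=> v _; rewrite lee_fin.
- exact: measurable_f.
- by move=> v; rewrite in_itv /= => /andP[/ltW va _]; rewrite lee_fin f_mono.
Qed.

Lemma riemann_bounds m h : 0 <= h ->
  ((h * \sum_(j < m) f (j%:R * h + h))%:E <= \int[mu]_(v in `]0%R, (m%:R * h)%R]) (f v)%:E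
    <= (h * \sum_(j < m) f (j%:R * h))%:E)%E.
Proof.
move=> h0; elim: m => [|m /andP[IH1 IH2]].
  by rewrite !big_ord0 mul0r mulr0 set_itvoc0 integral_set0 lexx.
have a0 : 0 <= m%:R * h by rewrite mulr_ge0.
have E : m.+1%:R * h = m%:R * h + h by rewrite -natr1 mulrDl mul1r.
have bU : `]0, m.+1%:R * h]%classic =
    `]0, m%:R * h]%classic `|` `](m%:R * h), (m%:R * h + h)]%classic.
  by rewrite E; apply: itv_bndbnd_setU; rewrite bnd_simp // lerDl.
rewrite bU ge0_integral_setU //=; last 3 first.
- by apply: measurable_f; apply: measurableU.
- by move=> v _; rewrite lee_fin.
- apply/disj_setPS => v [/=]; rewrite !in_itv /= => /andP[_ h1] /andP[h2 _].
  by have := lt_le_trans h2 h1; rewrite ltxx.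
have /andP[s1 s2] := integral_strip (m%:R * h) h0.
by rewrite !big_ord_recr /= !mulrDr !EFinD !leeD.
Qed.

End RiemannSums.

(** * Elementary geometric and exponential estimates *)

Lemma geometric_small {R : realType} (rho delta : R) : 0 <= rho < 1 -> 0 < delta ->
  exists2 K, (0 < K)%N & forall n, (K <= n)%N -> rho ^+ n <= delta.
Proof.
move=> /andP[r0 r1] d0.
have r1' : `|rho| < 1 by rewrite ger0_norm.
have [K _ HK] := cvgr_le (0 : R) (cvg_expr r1') _ d0.
by exists K.+1 => // n Kn; apply: HK; exact: ltnW.
Qed.

Lemma geometric_sum_le {R : realType} (rho : R) K N : 0 <= rho < 1 ->
  \sum_(i < N) rho ^+ (K + i) <= rho ^+ K / (1 - rho).
Proof.
move=> /andP[r0 r1]; have q0 : 0 < 1 - rho by rewrite subr_gt0.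
rewrite ler_pdivlMr //.
under eq_bigr do rewrite exprD.
rewrite -mulr_sumr -mulrA ler_piMr ?exprn_ge0 // mulrC -opprB mulNr -subrX1 opprB.
by rewrite gerBl exprn_ge0.
Qed.

(** From 1 - u <= exp (- u) comes exp u - 1 <= u / (1 - u), and 1 / (1 - u) <= 1 + eta when u <= eta
    / 2 and eta <= 1. *)
Lemma expR_sub1_le {R : realType} (eta u : R) : 0 < eta <= 1 -> 0 <= u <= eta / 2 ->
  expR u - 1 <= (1 + eta) * u.
Proof.
move=> /andP[e0 e1] /andP[u0 ue].
have := expR_ge1Dx (- u); rewrite expRN => h.
have ep := expR_gt0 u.
have : (1 - u) * expR u <= 1 by rewrite -ler_pdivlMr // mul1r.
nra.
Qed.

Lemma sub1_expRN_ge {R : realType} (eta u : R) : 0 < eta <= 1 -> 0 <= u <= eta / 2 ->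
  (1 - eta) * u <= 1 - expR (- u).
Proof.
move=> /andP[e0 e1] /andP[u0 ue].
have h := expR_ge1Dx u; rewrite expRN.
have u1 : 0 < 1 + u by rewrite ltr_wpDr.
have : (expR u)^-1 <= (1 + u)^-1 by rewrite lef_pV2 // posrE expR_gt0.
have : (1 + u) * (1 + u)^-1 = 1 by rewrite divff // gt_eqF.
set v := (1 + u)^-1; set w := (expR u)^-1 => hv hw.
have v0 : 0 < v by rewrite invr_gt0.
nra.
Qed.

(** * Asymptotics of the two bounds *)

Section Asymptotics.
Context {R : realType}.
Variables (alpha : R) (L G : R -> R) (r T lambda : R).
Hypothesis alpha_gt0 : 0 < alpha.
Hypothesis svL : slowly_varying L.
Hypothesis GE : forall x, 0 < x -> G x = L x / x `^ alpha.
Hypothesis G_le1 : forall x, G x <= 1.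
Hypothesis G_ge0 : forall x, 0 <= G x.
Hypothesis G_mono : forall x y, x <= y -> G y <= G x.
Hypothesis G_small : forall g, 0 < g -> exists M, forall x, M <= x -> G x <= g.
Hypotheses (r_gt0 : 0 < r) (T_gt0 : 0 < T) (lambda_gt0 : 0 < lambda).

(** For the claim tail [G] this is T times [FTbar], so the denominator of the theorem is lambda
    times it. *)
Definition tail_integral (x : R) : R :=
  fine (\int[lebesgue_measure]_(v in `]0%R, T]) (G (x * expR (r * v)))%:E)%E.

Let G_mono' x y : 0 < x -> x <= y -> G y <= G x.
Proof. by move=> _; exact: G_mono. Qed.

Lemma tail_integral_bounds x m : 0 < x -> (0 < m)%N ->
  let h := T / m%:R in
  [/\ h * \sum_(j < m) G (x * expR (r * (j%:R * h + h))) <= tail_integral x &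
      tail_integral x <= h * \sum_(j < m) G (x * expR (r * (j%:R * h)))].
Proof.
move=> x0 m0 h.
have h0 : 0 <= h by rewrite divr_ge0 // ltW.
have mh : m%:R * h = T by rewrite /h mulrC divfK // pnatr_eq0 -lt0n.
have fm u v : u <= v -> G (x * expR (r * v)) <= G (x * expR (r * u)).
  move=> uv; apply: G_mono; rewrite ler_wpM2l ?(ltW x0) // ler_expR ler_wpM2l //.
  exact: ltW.
have := riemann_bounds fm (fun u => G_ge0 _) m h0.
rewrite mh /tail_integral => /andP[h1 h2].
(* [fine] would send an infinite integral to 0; the real bounds on both sides exclude this. *)
have fin : (\int[lebesgue_measure]_(v in `]0%R, T]) (G (x * expR (r * v)))%:E)%E \is a fin_num.
  by apply/fin_numP; split; [move/eqP: h1|move/eqP: h2]; case: (integral _ _ _).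
by split; rewrite -lee_fin fineK.
Qed.

(** This lets error terms in [G x] be measured against the integral. A one-cell Riemann sum gives T
    G(x exp(rT)) <= integral, and [tail_dominated] undoes the factor exp(rT). *)
Lemma tail_le_integral : exists2 B, 0 < B & forall x, 0 < x -> G x <= B * tail_integral x.
Proof.
have k0 : 0 < expR (- (r * T)) by exact: expR_gt0.
have [A A0 HA] := tail_dominated svL GE G_le1 G_ge0 G_mono' k0.
exists (A / T); first by rewrite divr_gt0.
move=> x x0; have [] := @tail_integral_bounds x 1 x0 isT.
rewrite divr1 !big_ord1 !mul0r !add0r => h1 _.
have y0 : 0 < x * expR (r * T) by rewrite mulr_gt0 ?expR_gt0.
have := HA _ y0; rewrite mulrCA -expRD addNr expR0 mulr1 => h2.
apply: (le_trans h2); rewrite -mulrA ler_wpM2l ?(ltW A0) //.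
by rewrite ler_pdivlMl.
Qed.

(** The choices are joint: losing the factor 1 - eps and moving across one mesh cell must together
    cost at most 1 + eta. The bound on lambda h serves to linearize exponentials. *)
Lemma good_mesh eta : 0 < eta <= 1 -> exists eps m y0,
  [/\ 0 < eps < 1, (0 < m)%N, 0 < y0, lambda * (T / m%:R) <= eta / 2 &
   forall c y, (1 - eps) * expR (- (r * (T / m%:R))) <= c -> y0 <= y ->
     G (c * y) <= (1 + eta) * G y].
Proof.
move=> /andP[e0 e1].
have [c0 [y0 [/andP[c00 c01] y00 Hc]]] := tail_near_one alpha_gt0 svL GE G_ge0 G_mono' e0.
pose eps := (1 - c0) / 2.
have eps0 : 0 < eps by rewrite divr_gt0 // subr_gt0.
have c0e : c0 < 1 - eps by rewrite /eps; lra.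
have ce0 : 0 < 1 - eps by exact: lt_trans c0e.
(* If r h <= u, then exp (- r h) >= 1 - r h >= c0 / (1 - eps). *)
pose u := 1 - c0 / (1 - eps).
have u0 : 0 < u by rewrite subr_gt0 ltr_pdivrMr // mul1r.
pose h0 := Num.min (eta / 2 / lambda) (u / r).
have h00 : 0 < h0 by rewrite lt_min !divr_gt0.
pose m := (Num.truncn (T / h0)).+1.
have m0 : 0 < m%:R :> R by rewrite ltr0n.
have hm : T / m%:R <= h0.
  by rewrite ler_pdivrMr // mulrC -ler_pdivrMr // ltW // truncnS_gt.
exists eps, m, y0; split => //.
- by rewrite eps0 /= /eps; lra.
- rewrite mulrC -ler_pdivlMr //; apply: (le_trans hm); by rewrite ge_min lexx.
- move=> c y cc; apply: Hc; apply: le_trans cc.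
  have rh : r * (T / m%:R) <= u.
    by rewrite mulrC -ler_pdivlMr //; apply: (le_trans hm); rewrite ge_min lexx orbT.
  have := expR_ge1Dx (- (r * (T / m%:R))) => he.
  rewrite mulrC -ler_pdivrMr //; apply: le_trans he; move: rh; rewrite /u.
  lra.
Qed.

(** The order of choices matters: [eps] and the mesh from [eta], then [K] to make the contribution
    of many claims small, then [M], depending on [K], to make the squared tail small. The error is 3
    eta from the mesh and eta from each remainder. *)
Lemma upper_asymptotics q eta : 0 <= q < 1 -> 0 < eta <= 1 ->
  exists eps K m M, exists c : R -> R,
  [/\ 0 < eps < 1, (0 < K)%N, (0 < m)%N, 0 < M & forall x, M <= x ->
   (forall N, \sum_(i < N) q ^+ (K.+1 + i) *
     ((K.+1 + i)%:R * G (x / (K.+1 + i)%:R)) <= c x) /\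
   (expR (lambda * (T / m%:R)) - 1) *
      \sum_(j < m) G ((1 - eps) * x * expR (r * (j%:R * (T / m%:R))))
    + K%:R ^+ 2 * G (eps * x / K%:R) ^+ 2 + c x <= (1 + 5 * eta) * lambda * tail_integral x].
Proof.
move=> /andP[q0 q1] e01; have /andP[e0 e1] := e01.
have [eps [m [y0 [/andP[eps0 eps1] m0 y00 lh Hm]]]] := good_mesh e01.
have [B B0 HB] := tail_le_integral.
have q1' : 0 < 1 + q by rewrite ltr_wpDr.
(* Then q s = 2 q / (1 + q) stays below 1, so q^n still beats Potter's growth s^n. *)
pose s := 2 / (1 + q).
have s1 : 1 < s by rewrite ltr_pdivlMr //; lra.
have sE : s * (1 + q) = 2 by rewrite /s divfK // gt_eqF.
have s0 : 0 < s by exact: lt_trans s1.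
pose rho := q * s.
have rho01 : 0 <= rho < 1.
  rewrite mulr_ge0 ?(ltW s0) //=; rewrite /rho; nra.
have rho1 : 0 < 1 - rho by rewrite subr_gt0; case/andP: rho01.
have [A A0 HA] := tail_potter svL GE G_le1 G_ge0 G_mono' s1.
have d0 : 0 < eta * lambda * (1 - rho) / (A * B) by rewrite divr_gt0 ?mulr_gt0.
have [K K0 HK] := geometric_small rho01 d0.
have Kr0 : 0 < K%:R :> R by rewrite ltr0n.
have [A1 A10 HA1] := tail_dominated svL GE G_le1 G_ge0 G_mono' (divr_gt0 eps0 Kr0).
(* Once [G x] is below this level, K^2 (A1 G x)^2 is at most eta lambda G x / B, hence at most eta
   lambda times the integral. *)
have g0 : 0 < eta * lambda / (K%:R ^+ 2 * A1 ^+ 2 * B).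
  by rewrite divr_gt0 ?mulr_gt0 ?exprn_gt0.
have [M1 HM1] := G_small g0.
exists eps, K, m, (Num.max y0 M1), (fun x => A * (rho ^+ K.+1 / (1 - rho)) * G x).
split => //; first by rewrite eps0.
  by rewrite lt_max y00.
move=> x; rewrite ge_max => /andP[xy xM].
have x0 : 0 < x by exact: lt_le_trans xy.
have I0 : 0 <= tail_integral x.
  by rewrite -(pmulr_rge0 _ B0); apply: le_trans (HB x x0).
split.
  move=> N; apply: (@le_trans _ _ (\sum_(i < N) A * rho ^+ (K.+1 + i) * G x)).
    apply: ler_sum => i _; rewrite /rho exprMn.
    set n := (K.+1 + i)%N; have n0 : (0 < n)%N by [].
    have := ler_wpM2l (exprn_ge0 n q0) (HA n x n0 x0).
    by rewrite mulrA (mulrA (q ^+ n)) (mulrCA (q ^+ n)) !mulrA.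
  rewrite -mulr_suml -mulr_sumr ler_wpM2r // ler_wpM2l ?(ltW A0) //.
  exact: geometric_sum_le.
set h := T / m%:R in lh Hm *.
have h0 : 0 <= h by rewrite divr_ge0 // ltW.
have lh0 : 0 <= lambda * h by rewrite mulr_ge0 // ltW.
have main : (expR (lambda * h) - 1) *
    \sum_(j < m) G ((1 - eps) * x * expR (r * (j%:R * h))) <=
    (1 + 3 * eta) * lambda * tail_integral x.
  have [I1 _] := tail_integral_bounds x0 m0; rewrite -/h in I1.
  (* The left-endpoint sum with reduced thresholds is compared term by term with the lower Riemann
     sum, whose points lie one mesh step to the right. *)
  have G12 : \sum_(j < m) G ((1 - eps) * x * expR (r * (j%:R * h))) <=
      (1 + eta) * \sum_(j < m) G (x * expR (r * (j%:R * h + h))).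
    rewrite mulr_sumr; apply: ler_sum => j _.
    have -> : (1 - eps) * x * expR (r * (j%:R * h)) =
        ((1 - eps) * expR (- (r * h))) * (x * expR (r * (j%:R * h + h))).
      rewrite (_ : r * (j%:R * h) = - (r * h) + r * (j%:R * h + h)); last by ring.
      by rewrite expRD; ring.
    apply: Hm => //; apply: (le_trans xy); rewrite ler_peMr ?(ltW x0) //.
    rewrite -[leLHS]expR0 ler_expR mulr_ge0 ?(ltW r_gt0) // addr_ge0 // mulr_ge0 //.
  have a1 : expR (lambda * h) - 1 <= (1 + eta) * (lambda * h).
    by apply: expR_sub1_le => //; rewrite lh0.
  have S0 : 0 <= \sum_(j < m) G (x * expR (r * (j%:R * h + h))) by apply: sumr_ge0.
  have S1 : 0 <= \sum_(j < m) G ((1 - eps) * x * expR (r * (j%:R * h))) by apply: sumr_ge0.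
  set S := \sum_(j < m) G (x * _) in I1 G12 S0 *.
  apply: (@le_trans _ _ ((1 + eta) * (lambda * h) * ((1 + eta) * S))).
    apply: ler_pM => //; rewrite subr_ge0 -[leLHS]expR0 ler_expR //.
  have -> : (1 + eta) * (lambda * h) * ((1 + eta) * S) = (1 + eta) ^+ 2 * lambda * (h * S) by ring.
  apply: ler_pM => //.
  - by rewrite mulr_ge0 ?(ltW lambda_gt0) // sqr_ge0.
  - exact: mulr_ge0.
  - rewrite ler_wpM2r ?(ltW lambda_gt0) //; nra.
have second : K%:R ^+ 2 * G (eps * x / K%:R) ^+ 2 <= eta * lambda * tail_integral x.
  have g1 : G (eps * x / K%:R) <= A1 * G x.
    by have := HA1 x x0; rewrite mulrAC.
  apply: (@le_trans _ _ (K%:R ^+ 2 * (A1 * G x) ^+ 2)).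
    by rewrite ler_wpM2l ?sqr_ge0 // lerXn2r ?nnegrE ?mulr_ge0 ?(ltW A10).
  have g2 := HM1 x xM; rewrite ler_pdivlMr ?mulr_gt0 ?exprn_gt0 // in g2.
  have g3 := HB x x0.
  rewrite exprMn [X in _ * (_ * X)]expr2 mulrA mulrA.
  apply: (@le_trans _ _ (K%:R ^+ 2 * A1 ^+ 2 * G x * (B * tail_integral x))).
    by rewrite ler_wpM2l // mulr_ge0 // mulr_ge0 ?sqr_ge0.
  rewrite mulrA ler_wpM2r //; apply: le_trans g2.
  by rewrite [leRHS]mulrC mulrAC.
have third : A * (rho ^+ K.+1 / (1 - rho)) * G x <= eta * lambda * tail_integral x.
  have h1 := HK K.+1 (leqnSn K).
  apply: (@le_trans _ _ (A * (rho ^+ K.+1 / (1 - rho)) * (B * tail_integral x))).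
    rewrite ler_wpM2l ?HB // mulr_ge0 ?(ltW A0) // divr_ge0 ?(ltW rho1) // exprn_ge0 //.
    by case/andP: rho01.
  rewrite mulrA ler_wpM2r //.
  rewrite ler_pdivlMr ?mulr_gt0 // in h1.
  rewrite mulrA mulrAC ler_pdivrMr //; apply: le_trans h1.
  by rewrite mulrCA mulrA.
move: main second third; lra.
Qed.

(** Linearizing the exponential and truncating at [K] each cost a factor 1 - eta, the mesh a factor
    1 / (1 + eta); their product is at least 1 - 3 eta, and the squared tail takes the fourth
    eta. *)
Lemma lower_asymptotics q p eta : 0 <= q < 1 -> 0 <= p -> 0 < eta <= 1 ->
  exists K m M, [/\ (0 < m)%N, 0 < M & forall x, M <= x ->
   (1 - 4 * eta) * lambda * tail_integral x <=
   exp_cdf lambda (T / m%:R) * (1 - q ^+ K) *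
    \sum_(j < m) G ((x + p) * expR (r * (j%:R * (T / m%:R) + T / m%:R)))
    - K%:R ^+ 2 * G x ^+ 2].
Proof.
move=> q01 p0 e01; have /andP[e0 e1] := e01.
have [eps [m [y0 [/andP[eps0 eps1] m0 y00 lh Hm]]]] := good_mesh e01.
have [B B0 HB] := tail_le_integral.
have [K K0 HK] := geometric_small q01 e0.
have Kr0 : 0 < K%:R :> R by rewrite ltr0n.
have g0 : 0 < eta * lambda / (K%:R ^+ 2 * B).
  by rewrite divr_gt0 ?mulr_gt0 ?exprn_gt0.
have [M1 HM1] := G_small g0.
(* For x >= p / eps one has x / (x + p) >= 1 - eps, so the premium shift fits in the margin of
   [good_mesh]. *)
exists K, m, (Num.max y0 (Num.max M1 (p / eps))); split => //.
  by rewrite lt_max y00.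
move=> x; rewrite !ge_max => /and3P[xy xM xp].
have x0 : 0 < x by exact: lt_le_trans xy.
have I0 : 0 <= tail_integral x.
  by rewrite -(pmulr_rge0 _ B0); apply: le_trans (HB x x0).
have xp0 : 0 < x + p by rewrite ltr_wpDr.
set h := T / m%:R in lh Hm *.
have h0 : 0 <= h by rewrite divr_ge0 // ltW.
have lh0 : 0 <= lambda * h by rewrite mulr_ge0 // ltW.
have second : K%:R ^+ 2 * G x ^+ 2 <= eta * lambda * tail_integral x.
  have g2 := HM1 x xM; rewrite ler_pdivlMr ?mulr_gt0 ?exprn_gt0 // in g2.
  have g3 := HB x x0.
  rewrite [X in _ * X]expr2 mulrA.
  apply: (@le_trans _ _ (K%:R ^+ 2 * G x * (B * tail_integral x))).
    by rewrite ler_wpM2l // mulr_ge0 // sqr_ge0.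
  rewrite mulrA ler_wpM2r //; apply: le_trans g2.
  by rewrite [leRHS]mulrC mulrAC.
have [_ I1] := tail_integral_bounds x0 m0; rewrite -/h in I1.
set S := \sum_(j < m) G ((x + p) * _).
have S0 : 0 <= S by apply: sumr_ge0.
have G12 : \sum_(j < m) G (x * expR (r * (j%:R * h))) <= (1 + eta) * S.
  rewrite mulr_sumr; apply: ler_sum => j _.
  have -> : x * expR (r * (j%:R * h)) =
      (x / (x + p) * expR (- (r * h))) * ((x + p) * expR (r * (j%:R * h + h))).
    rewrite (_ : r * (j%:R * h) = - (r * h) + r * (j%:R * h + h)); last by ring.
    by rewrite expRD; field; rewrite gt_eqF.
  apply: Hm.
    rewrite ler_wpM2r ?expR_ge0 // ler_pdivlMr //.
    rewrite ler_pdivrMr // in xp; nra.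
  apply: (le_trans xy); apply: (@le_trans _ _ (x + p)); first by rewrite lerDl.
  rewrite ler_peMr ?(ltW xp0) // -[leLHS]expR0 ler_expR mulr_ge0 ?(ltW r_gt0) //.
  by rewrite addr_ge0 // mulr_ge0.
have a1 : (1 - eta) * (lambda * h) <= exp_cdf lambda h.
  by apply: sub1_expRN_ge => //; rewrite lh0.
have q1 : 1 - eta <= 1 - q ^+ K by rewrite lerD2l lerN2 HK.
have e1' : 0 <= 1 - eta by rewrite subr_ge0.
have main : (1 - 3 * eta) * lambda * tail_integral x <=
    exp_cdf lambda h * (1 - q ^+ K) * S.
  apply: (@le_trans _ _ ((1 - eta) * (lambda * h) * (1 - eta) * S)); last first.
    by rewrite ler_wpM2r // ler_pM // mulr_ge0.
  have hS : tail_integral x <= (1 + eta) * (h * S).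
    by apply: (le_trans I1); rewrite mulrCA ler_wpM2l.
  have lI : lambda * tail_integral x <= (1 + eta) * (lambda * (h * S)).
    by rewrite mulrCA ler_wpM2l // ltW.
  have hS0 : 0 <= lambda * (h * S) by rewrite !mulr_ge0 // ltW.
  have lI0 : 0 <= lambda * tail_integral x by rewrite mulr_ge0 // ltW.
  have -> : (1 - eta) * (lambda * h) * (1 - eta) * S = (1 - eta) ^+ 2 * (lambda * (h * S)) by ring.
  rewrite -mulrA; move: lI hS0 lI0.
  set u := lambda * tail_integral x; set v := lambda * (h * S) => lI v0 u0.
  (* If 1 - 3 eta <= 0 the left side is nonpositive. Otherwise the bound may be multiplied by it,
     and (1 - 3 eta)(1 + eta) <= (1 - eta)^2. *)
  have [h3|h3] := leP (1 - 3 * eta) 0.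
    apply: (@le_trans _ _ 0); first by rewrite mulr_le0_ge0.
    by rewrite mulr_ge0 // sqr_ge0.
  apply: (@le_trans _ _ ((1 - 3 * eta) * ((1 + eta) * v))).
    by rewrite ler_wpM2l // ltW.
  rewrite mulrA ler_wpM2r //; nra.
move: main second; lra.
Qed.

End Asymptotics.

(** * Vanishing of the claim tail, and the limit *)

Lemma claim_tail_small {R : realType} {d : measure_display} {Omega : measurableType d}
    (P : probability Omega R) (X : Omega -> R) (g : R) : measurable_fun setT X -> 0 < g ->
  exists M, forall x, M <= x -> pr P [set w | x < X w] <= g.
Proof.
move=> mX g0.
pose Y : {mfun Omega >-> R} := mfun_Sub (mem_set mX).
have /fine_cvgP[_ lim] := @cvg_ccdfy0 _ _ _ P Y.
have [M [Mr HM]] := cvgr_le (0 : R) lim _ g0.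
exists (M + 1) => x Mx; apply: le_trans (HM x _); last by apply: lt_le_trans Mx; rewrite ltrDl.
rewrite /= /ccdf /distribution /pushforward /pr.
rewrite (_ : [set w | x < X w] = Y @^-1` `]x, +oo[%classic) //.
by apply/seteqP; split => w /=; rewrite in_itv /= andbT.
Qed.

Theorem theorem3p3 (R : realType) (d : measure_display) (Omega : measurableType d)
    (P : probability Omega R)
    (r c1 c2 delta1 delta2 lambda alpha T : R) (L : R -> R)
    (E sigma : nat -> Omega -> R) :
  0 < r -> 0 < c1 -> 0 < c2 ->
  0 < delta1 < 1 -> 0 < delta2 < 1 -> delta1 + delta2 = 1 ->
  c1 / delta1 > c2 / delta2 ->
  0 < lambda -> 0 < alpha -> 0 < T ->
                                                                          
                                                           
  mutually_independent P (claim_family E sigma) ->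
  (forall k t, 0 <= t -> P [set w | t < E k w] = (expR (- (lambda * t)))%:E) ->
                                                                   
  (forall k w, 0 <= sigma k w) ->
  (forall k x, 0 < x -> P [set w | x < sigma k w] = (L x / x `^ alpha)%:E) ->
  (forall x, 0 < x -> {for x, continuous L}) ->
  slowly_varying L ->
  L x @[x --> +oo] --> +oo ->
  let p1 := c1 / (r * delta1) in
  let p2 := c2 / (r * delta2) in
  forall eps, 0 < eps -> exists M, forall x1 x2, M <= x1 -> x1 <= x2 ->
    `| Psi_min P r p1 p2 E sigma x1 x2 T
         / (lambda * T * FTbar P r T (sigma 0%N) x1) - 1 | < eps.
Proof.
move=> r0 c10 c20 /andP[d10 _] /andP[d20 _] _ _ l0 a0 T0 indep exp_law sigma0 tailE _ svL _ p1 p2 eps eps0.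
have p10 : 0 <= p1 by rewrite divr_ge0 ?mulr_ge0 // ltW.
have p20 : 0 <= p2 by rewrite divr_ge0 ?mulr_ge0 // ltW.
pose G y := pr P [set w | y < sigma 0%N w].
have mG y : measurable [set w | y < sigma 0%N w] by exact: (measurable_claim_gt indep).
have GE x : 0 < x -> G x = L x / x `^ alpha by move=> x0; rewrite /G /pr tailE.
have claim_tail k y : 0 < y -> P [set w | y < sigma k w] = (G y)%:E.
  by move=> y0; rewrite GE // tailE.
have G1 x : G x <= 1 by exact: pr_le1.
have G0 x : 0 <= G x by exact: pr_ge0.
have Gm x y : x <= y -> G y <= G x.
  by move=> xy; apply: pr_le => // w /=; exact: le_lt_trans.
have Gs g : 0 < g -> exists M, forall x, M <= x -> G x <= g.
  exact: (claim_tail_small P (measurable_claim indep 0%N)).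
(* The minimum ensures eta <= 1, and the divisor 8 ensures 5 eta < eps. *)
pose eta := Num.min 1 eps / 8.
have m0 : 0 < Num.min 1 eps by rewrite lt_min ltr01.
have m1 : Num.min 1 eps <= 1 by rewrite ge_min lexx.
have me : Num.min 1 eps <= eps by rewrite ge_min lexx orbT.
have e01 : 0 < eta <= 1 by rewrite /eta; apply/andP; split; lra.
have e5 : 5 * eta < eps by rewrite /eta; lra.
have q01 : 0 <= exp_cdf lambda T < 1.
  by rewrite exp_cdf_lt1 andbT exp_cdf_ge0 // ltW.
have [ep [K [m [M1 [c [ep01 K0 mm0 M10 H1]]]]]] :=
  upper_asymptotics a0 svL GE G1 G0 Gm Gs r0 T0 l0 q01 e01.
have [K' [m' [M2 [mm0' M20 H2]]]] :=
  lower_asymptotics a0 svL GE G1 G0 Gm Gs r0 T0 l0 q01 p10 e01.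
have [B B0 HB] := tail_le_integral svL GE G1 G0 Gm r0 T0.
exists (Num.max M1 M2) => x1 x2; rewrite ge_max => /andP[x1M x1M'] x12.
have x10 : 0 < x1 by exact: lt_le_trans x1M.
pose I0 := tail_integral G r T x1.
have I0p : 0 < I0.
  have Gp : 0 < G x1 by apply: (tail_gt0 svL GE) => // x y _; exact: Gm.
  by rewrite -(pmulr_rgt0 _ B0); apply: lt_le_trans (HB x1 x10).
have -> : lambda * T * FTbar P r T (sigma 0%N) x1 = lambda * I0.
  by rewrite /FTbar mulrA mulfK ?gt_eqF.
have -> : Psi_min P r p1 p2 E sigma x1 x2 T = pr P (ruin E sigma r T p1 p2 x1 x2) by [].
have [Hc Hu] := H1 x1 x1M.
have [ep0 ep1] := andP ep01.
(* Taking x = x1 as common lower bound of the reserves keeps the estimate free of [x2], hence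
   uniform in x2 >= x1. *)
have up := ruin_upper indep r0 T0 l0 exp_law sigma0 claim_tail p10 p20 x10 (lexx x1) x12
  ep0 ep1 K0 mm0 Hc.
have lo := ruin_lower indep r0 T0 l0 exp_law sigma0 claim_tail x2 K' p10 p20 x10 mm0'.
have {}up := le_trans up Hu.
have {}lo := le_trans (H2 x1 x1M') lo.
have lI : 0 < lambda * I0 by rewrite mulr_gt0.
rewrite ltr_norml; apply/andP; split.
  rewrite ltrBrDl ltr_pdivlMr //.
  apply: lt_le_trans lo; rewrite -mulrA ltr_pM2r //; lra.
rewrite ltrBlDl ltr_pdivrMr //.
apply: (le_lt_trans up); rewrite -mulrA ltr_pM2r //; lra.
Qed.
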